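(* Let $q\geq 2$ be an integer. Then: (i) $\eta(\mathcal{D}_q)+\eta(\mathcal{D}_q)=[c_q,+\infty)$, where $$c_q=2\,\zeta^\star(\{q\}^{\infty})=2\prod_{n\geq 2}\frac{1}{1-\frac{1}{n^q}}.$$ (ii) $\eta(\mathcal{D}_q)\cdot\eta(\mathcal{D}_q)=[d_q,+\infty)$, where $$d_q=\left(\zeta^\star(\{q\}^{\infty})\right)^2=\prod_{n\geq 2}\frac{1}{\left(1-\frac{1}{n^q}\right)^2}.$$ (iii) $\eta(\mathcal{D}_q)-\eta(\mathcal{D}_q)=\mathbb{R}$. (iv) $\eta(\mathcal{D}_q)/\eta(\mathcal{D}_q)=(0,+\infty)$.
   Context: $\mathbb{N}=\{1,2,3,\dots\}$. For positive integers $k_1,\dots,k_r$ with $k_1\geq 2$, the multiple zeta-star value is $$\zeta^\star(k_1,\dots,k_r)=\sum_{n_1\geq n_2\geq\cdots\geq n_r\geq 1}\frac{1}{n_1^{k_1}\cdots n_r^{k_r}}.$$ Let $\mathcal{T}$ be the set of all infinite sequences $(k_1,k_2,\dots,k_r,\dots)$ of positive integers such that $k_1\geq 2$ and, if $k_1=2$, then $k_s\geq 2$ for some $s\geq 2$ (so $(2,1,1,1,\dots)$ is excluded). The map $\eta:\mathcal{T}\to(1,+\infty)$ is defined by $$\eta\big((k_1,k_2,\dots)\big)=\lim_{r\to+\infty}\zeta^\star(k_1,\dots,k_r),$$ and one also writes $\zeta^\star(k_1,k_2,\dots)$ for $\eta((k_1,k_2,\dots))$. The notation $\{q\}^{\infty}$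 denotes the constant infinite sequence $(q,q,q,\dots)$. For an integer $q\geq 2$, $$\mathcal{D}_q=\{(k_1,k_2,\dots)\in\mathcal{T}\;:\;k_i\leq q\text{ for all }i\geq 1\}.$$ For sets $A,B\subseteq(0,+\infty)$: $A+B=\{a+b: a\in A,b\in B\}$, $A-B=\{a-b: a\in A,b\in B\}$, $A\cdot B=\{ab: a\in A,b\in B\}$, $A/B=\{a/b: a\in A,b\in B\}$. *)

(* Defs.v *)
From HB Require Import structures.
From mathcomp Require Import all_boot all_order all_algebra.
From mathcomp Require Import all_classical all_reals all_analysis.
Import Order.TTheory GRing.Theory Num.Theory.
Import numFieldNormedType.Exports.
Set Implicit Arguments.
Unset Strict Implicit.
Unset Printing Implicit Defensive.
Local Open Scope classical_set_scope.
Local Open Scope ring_scope.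

(* An index (k_1, ..., k_r) is a [seq nat]; an infinite index (k_1, k_2, ...)
   is a function [k : nat -> nat] numbered from 0, so that [k i] is k_(i+1). *)

Definition star_dom (r : nat) : set (r.-tuple nat) :=
  [set n : r.-tuple nat | sorted geq n /\ forall i, (0 < tnth n i)%N].

(* The terms are nonnegative, so the unordered sum [esum] is the multiple sum;
   it is finite when k_1 >= 2. *)
Definition zeta_star (R : realType) (k : seq nat) : R :=
  fine (\esum_(n in @star_dom (size k))
          (\prod_(i < size k) ((tnth n i)%:R ^+ nth 0%N k i)^-1)%:E)%E.

Definition calT : set (nat -> nat) :=
  [set k : nat -> nat | [/\ forall i, (0 < k i)%N, (2 <= k 0%N)%N &
    k 0%N = 2%N -> exists2 s, (1 <= s)%N & (2 <= k s)%N]].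

Definition eta_star (R : realType) (k : nat -> nat) : R :=
  limn (fun r => zeta_star R (mkseq k r)).

Definition calD (q : nat) : set (nat -> nat) :=
  [set k | calT k /\ forall i, (k i <= q)%N].

(* [p] is the value of the (convergent) infinite product of the [a n], n >= 2 *)
Definition is_infprod_ge2 (R : realType) (a : nat -> R) (p : R) : Prop :=
  (\prod_(2 <= n < N) a n) @[N --> \oo] --> p.

(* Main.v *)
Require Import Defs.
From HB Require Import structures.
From mathcomp Require Import all_boot all_order all_algebra.
From mathcomp Require Import all_classical all_reals all_analysis.
From mathcomp Require Import ring lra.
Import Order.TTheory GRing.Theory Num.Theory.
Import numFieldNormedType.Exports.
Set Implicit Arguments.
Unset Strict Implicit.
Unset Printing Implicit Defensive.
Local Open Scope classical_set_scope.
Local Open Scope ring_scope.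

(** Put S_j g (n) = sum of g(m) / m^j over 1 <= m <= n.  Truncating the series
    of zeta-star(k_1, ..., k_r) at n_1 <= n gives S_(k_1) ... S_(k_r) 1 (n);
    write L_k g for the limit in n of S_(k_1) ... S_(k_r) g (n), possibly
    infinite.  The identity id(n) = n is fixed by S_1 and the truncated product
    P(n) = prod_(2 <= i <= n) 1 / (1 - i^(-q)) is fixed by S_q, so a tail
    1, 1, ... amounts to replacing the function 1 by id, a tail q, q, ... to
    replacing it by P, and the values of eta at the sequences of D_q with
    prefix k run from L_k P to L_k id.  Since S_(j+1) id = S_j 1, the values
    with prefix (k, j+1) stop at L_(k,j) 1 while those with prefix (k, j) start
    at L_(k,j) P.  So A = eta(D_q) is a Cantor-like closed set: its complement
    in [min A, +oo) is the union of the gaps ]L_(k,j) 1, L_(k,j) P[ for j < q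
    ([eta_hits], [eta_outside_gap], [etaD_gapP]).

    Everything then rests on the bound P(n) <= 2 n / (n + 1), an equality for
    q = 2.  It gives P(n) (1 + 1/n) <= 2: a gap is at most as long as the piece
    of A just below it ([gap_left_below]).  It also gives P(n)^2 <= n: by
    Cauchy-Schwarz (L_k P)^2 <= L_k 1 * L_k id, so even on a logarithmic scale
    a gap is at most as long as the cylinder just above it
    ([gaps_separated]).  Hence both A and ln A are thick in the sense of
    Newhouse: the distance of two gaps is at least the smaller of their lengths
    ([etaD_thick], [lnA_thick]).

    Newhouse's gap lemma ([gap_descent]) makes two thick sets meet as soon as
    a gap of one is linked with a longer gap of the other lying on its right.
    Meeting A with t - A writes t as a sum ([thick_sum]), meeting it with t + A
    writes t as a difference; products and quotients are sums and differences
    in ln A.  The reflected set t - A has a greatest element, at which the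
    linked pair is found.  For translates one uses the gaps
    ]L_k 1, L_k P[ with k = (2, 1, ..., 1), which tend to infinity: their
    lengths increase, which settles differences ([etaD_sub_gt0]); their limit
    bounds every gap of A, so that far enough to the right the gap of r A is
    relatively longer than those of A as soon as r > 1, which settles quotients
    ([etaD_div_gt1]). *)

(** * Thick sets and the gap lemma *)

Section Gaps.
Context {R : realType}.
Implicit Types (A C D : set R) (x y v w z t : R).

Definition gap A x y : Prop :=
  [/\ A x, A y, x < y & forall z, A z -> z <= x \/ y <= z].

(** Thickness at least 1 in the sense of Newhouse, stated without bridges: of
    two gaps, the shorter one fits in between.  The last clause is the same
    condition for a gap and the unbounded component of the complement on its
    left. *)
Definition thick A : Prop :=
  [/\ closed A,
    forall x y x' y', gap A x y -> gap A x' y' -> y <= x' ->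
      y - x <= x' - y \/ y' - x' <= x' - y &
    forall x y, gap A x y -> exists2 p, A p & p <= x - (y - x)].

Lemma closed_adherent A l : closed A ->
  (forall e, 0 < e -> exists2 a, A a & `|l - a| < e) -> A l.
Proof.
move=> clA h; apply: clA => B /nbhs_ballP[e /= e0 eB].
by have [a Aa la] := h _ e0; exists a; split => //; apply: eB.
Qed.

Lemma gap_around A a z b : closed A -> A a -> A b -> a < z < b -> ~ A z ->
  exists x y, gap A x y /\ x < z < y.
Proof.
move=> clA Aa Ab /andP[az zb] nAz.
pose X := A `&` [set u | u <= z]; pose Y := A `&` [set u | z <= u].
have supX : has_sup X by split; [exists a; split => //=; exact: ltW | exists z => u []].
have infY : has_inf Y by split; [exists b; split => //=; exact: ltW | exists z => u []].
have AX : A (sup X).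
  apply: closed_adherent => // e e0.
  have [u [Au uz] ue] := sup_adherent e0 supX.
  exists u => //; have := sup_upper_bound supX (conj Au uz).
  by rewrite ltr_norml => ?; apply/andP; split; lra.
have AY : A (inf Y).
  apply: closed_adherent => // e e0.
  have [u [Au uz] ue] := inf_adherent e0 infY.
  exists u => //; have := ge_inf infY.2 (conj Au uz).
  by rewrite ltr_norml => ?; apply/andP; split; lra.
have Xz : sup X < z.
  rewrite lt_neqAle; apply/andP; split; first by apply: contra_notN nAz => /eqP <-.
  by apply: ge_sup => //; [case: supX | move=> u []].
have Yz : z < inf Y.
  rewrite lt_neqAle; apply/andP; split; first by apply: contra_notN nAz => /eqP ->.
  by apply: lb_le_inf => //; [case: infY | move=> u []].
exists (sup X), (inf Y); split; last by rewrite Xz.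
split => //; first exact: lt_trans Yz.
move=> u Au; have [uz|zu] := leP u z.
  by left; apply: sup_upper_bound.
by right; apply: (ge_inf infY.2); split => //; exact: ltW.
Qed.

(** The left end x of the shorter gap is not in D, hence lies in a gap of D on
    the left of ]v, w[; thickness of D makes that gap even shorter than
    ]x, y[, so the roles of C and D are exchanged and the situation recurs. *)
Lemma gap_descent_step C D x y v w : thick D -> (forall z, C z -> ~ D z) ->
  gap C x y -> gap D v w -> x < v < y -> y < w -> y - x <= w - v ->
  exists v' w', [/\ gap D v' w', v' < x < w', w' < y & w' - v' <= y - x].
Proof.
move=> [clD TD LD] CD gC gD /andP[xv vy] yw le.
have [d Dd dv] := LD _ _ gD; have [Cx _ _ _] := gC; have [Dv _ _ _] := gD.
have [|v' [w' [g' /andP[v'x xw']]]] := @gap_around D d x v clD Dd Dv _ (CD _ Cx).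
  by apply/andP; split; lra.
have w'v : w' <= v.
  by have [_ _ _ /(_ _ Dv)[|//]] := g'; lra.
by exists v', w'; split => //; [rewrite v'x xw'|lra|case: (TD _ _ _ _ g' gD w'v); lra].
Qed.

(** Newhouse's gap lemma.  If C and D were disjoint, [gap_descent_step] could be
    repeated forever, producing left ends that alternate between C and D and
    move left; their infimum is a limit of points of C and of points of D. *)
Lemma gap_descent C D m x y v w : thick C -> thick D ->
  (forall z, C z -> m <= z) ->
  gap C x y -> gap D v w -> x < v < y -> y < w -> y - x <= w - v ->
  exists2 z, C z & D z.
Proof.
move=> tC tD Cm gC gD xvy yw le; apply: contrapT => nCD.
have CD z : C z -> ~ D z by move=> Cz Dz; apply: nCD; exists z.
have DC z : D z -> ~ C z by move=> Dz Cz; apply: nCD; exists z.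
pose St A B a := exists b c d,
  [/\ gap A a b, gap B c d, a < c < b, b < d & b - a <= d - c].
have StCD a : St C D a -> exists2 c, St D C c & c < a.
  move=> [b [c [d [g1 g2 h1 h2 h3]]]].
  have [v' [w' [g' /andP[h4 h5] h6 h7]]] := gap_descent_step tD CD g1 g2 h1 h2 h3.
  by exists v' => //; exists w', a, b; split; rewrite ?h4.
have StDC a : St D C a -> exists2 c, St C D c & c < a.
  move=> [b [c [d [g1 g2 h1 h2 h3]]]].
  have [v' [w' [g' /andP[h4 h5] h6 h7]]] := gap_descent_step tC DC g1 g2 h1 h2 h3.
  by exists v' => //; exists w', a, b; split; rewrite ?h4.
pose E := [set a | St C D a].
have infE : has_inf E.
  split; first by exists x, y, v, w.
  by exists m => a [b [c [d [[Ca _ _ _] _ _ _ _]]]]; exact: Cm.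
have lbE a : E a -> inf E <= a by exact: ge_inf infE.2 _.
apply: (CD (inf E)); apply: closed_adherent.
- by case: tC.
- move=> e e0; have [a Ea ae] := inf_adherent e0 infE.
  exists a; first by case: Ea => b [c [d [[]]]].
  by have := lbE _ Ea; rewrite ltr_norml => ?; apply/andP; split; lra.
- by case: tD.
- move=> e e0; have [a Ea ae] := inf_adherent e0 infE.
  have [c Sc ca] := StCD _ Ea; have [a' /lbE Ea' a'c] := StDC _ Sc.
  exists c; first by case: Sc => b [c' [d [[]]]].
  by rewrite ltr_norml; apply/andP; split; lra.
Qed.

(** A point M of D such that every gap of D below M is at most as far from M as
    it is long behaves like the left end of an infinitely long gap of D: it
    supplies the linked pair from which [gap_descent] starts. *)
Lemma meet_from_right_end C D m M c c' d : thick C -> thick D ->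
  (forall z, C z -> m <= z) -> D M ->
  (forall v w, gap D v w -> w <= M -> w - v <= M - w) ->
  C c -> c <= M -> C c' -> M <= c' -> D d -> d <= m ->
  exists2 z, C z & D z.
Proof.
move=> tC tD Cm DM rM Cc cM Cc' Mc' Dd dm; apply: contrapT => nCD.
have CD z : C z -> ~ D z by move=> Cz Dz; apply: nCD; exists z.
have DC z : D z -> ~ C z by move=> Dz Cz; apply: nCD; exists z.
have neq z z' : C z -> D z' -> z != z'.
  by move=> Cz Dz'; apply/eqP => zz'; apply: (CD z) => //; rewrite zz'.
have [clC _ _] := tC; have [clD _ _] := tD.
have := neq _ _ Cc DM; have := neq _ _ Cc' DM => n1 n2.
have [|x [y [gC /andP[xM My]]]] := @gap_around C c M c' clC Cc Cc' _ (DC _ DM).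
  by rewrite !lt_neqAle cM Mc' n2 eq_sym n1.
have [Cx _ _ _] := gC.
have dx : d < x by rewrite lt_neqAle eq_sym neq//= (le_trans dm)// Cm.
have [|v [w [gD /andP[vx xw]]]] := @gap_around D d x M clD Dd DM _ (CD _ Cx).
  by rewrite dx.
have wM : w <= M by have [_ _ _ /(_ _ DM)[]] := gD => //; lra.
have wv := rM _ _ gD wM.
have [v' [w' [g' h4 h6 h7]]] : exists v' w',
    [/\ gap C v' w', v' < v < w', w' < w & w' - v' <= w - v].
  by apply: (gap_descent_step tC DC gD gC); [rewrite vx|lra|lra].
by apply: nCD; apply: (gap_descent tC tD Cm g' gD) => //.
Qed.

(** The linked pair consists here of a gap of D and of the gap of C that contains
    its left end; being shorter, the latter cannot reach beyond the former. *)
Lemma meet_from_large_gap C D m c c' v w : thick C -> thick D ->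
  (forall z, C z -> m <= z) -> gap D v w ->
  (forall x y, gap C x y -> x < v < y -> y - x <= w - v) ->
  C c -> c <= v -> C c' -> v <= c' ->
  exists2 z, C z & D z.
Proof.
move=> tC tD Cm gD rM Cc cv Cc' vc'; apply: contrapT => nCD.
have [Dv _ _ _] := gD.
have nCv : ~ C v by move=> Cv; apply: nCD; exists v.
have neq z : C z -> z != v by move=> Cz; apply/eqP => zz'; apply: nCv; rewrite -zz'.
have [clC _ _] := tC.
have [|x [y [gC /andP[xM My]]]] := @gap_around C c v c' clC Cc Cc' _ nCv.
  by rewrite !lt_neqAle cv vc' neq//= eq_sym neq.
have le : y - x <= w - v by apply: rM => //; rewrite xM.
by apply: nCD; apply: (gap_descent tC tD Cm gC gD); rewrite ?xM//; lra.
Qed.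

Lemma gap_shift A t x y : gap [set z | A (z - t)] x y <-> gap A (x - t) (y - t).
Proof.
split=> -[h1 h2 h3 h4]; split => //=; rewrite ?ltrD2r// in h3 *.
- move=> z Az; case: (h4 (z + t)) => /=; rewrite ?addrK// => h.
    by left; rewrite lerBrDr.
  by right; rewrite lerBlDr.
- by move=> z /= /h4; rewrite !lerD2r.
Qed.

Lemma gap_reflect A t x y : gap [set z | A (t - z)] x y <-> gap A (t - y) (t - x).
Proof.
split=> -[h1 h2 h3 h4]; split => //=.
- by rewrite ltrD2l ltrN2.
- move=> z Az; case: (h4 (t - z)) => /=; rewrite ?subKr// => h.
    by right; rewrite lerBlDl -lerBlDr.
  by left; rewrite lerBrDl -lerBrDr.
- by move: h3; rewrite ltrD2l ltrN2.
- by move=> z /= /h4[]; rewrite lerD2l lerN2; [right|left].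
Qed.

Lemma closed_shift A t : closed A -> closed [set z | A (z - t)].
Proof.
move=> clA; apply: (@closed_comp _ _ (fun z : R => z - t)) => // z _.
by apply: cvgB; [exact: cvg_id|exact: cvg_cst].
Qed.

Lemma closed_reflect A t : closed A -> closed [set z | A (t - z)].
Proof.
move=> clA; apply: (@closed_comp _ _ (fun z : R => t - z)) => // z _.
by apply: cvgB; [exact: cvg_cst|exact: cvg_id].
Qed.

Lemma thick_shift A t : thick A -> thick [set z | A (z - t)].
Proof.
move=> [clA TA LA]; split; first exact: closed_shift.
- move=> x y x' y' /gap_shift g /gap_shift g' le.
  by have := TA _ _ _ _ g g'; rewrite lerD2r => /(_ le) []; [left|right]; lra.
- move=> x y /gap_shift /LA [p Ap le]; exists (p + t); last lra.
  by rewrite /= addrK.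
Qed.

(** Reflection exchanges left and right, and an unbounded set satisfies the
    condition on the right for free. *)
Lemma thick_reflect A t : thick A -> (forall b, exists2 a, A a & b <= a) ->
  thick [set z | A (t - z)].
Proof.
move=> [clA TA LA] ub; split; first exact: closed_reflect.
- move=> x y x' y' /gap_reflect g /gap_reflect g' le.
  by have := TA _ _ _ _ g' g; case=> [||]; [lra|right; lra|left; lra].
- move=> x y _; have [a Aa le] := ub (t - (x - (y - x))).
  by exists (t - a); [rewrite /= subKr | lra].
Qed.

(** A meets t - A: the greatest element t - m of t - A is where the descent
    starts. *)
Lemma thick_sum A m t : thick A -> A m -> (forall z, A z -> m <= z) ->
  (forall b, exists2 a, A a & b <= a) -> m + m <= t ->
  exists a b, [/\ A a, A b & a + b = t].
Proof.
move=> tA Am mA ub mt; have tD := @thick_reflect A t tA ub.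
have [c Ac tc] := ub (t - m).
have [] := @meet_from_right_end A [set z | A (t - z)] m (t - m) m c (t - c) tA tD mA.
- by rewrite /= subKr.
- move=> v w /gap_reflect g wt; have [_ _ LA] := tA.
  by have [p /mA Ap le] := LA _ _ g; lra.
- by [].
- lra.
- by [].
- by [].
- by rewrite /= subKr.
- lra.
- by move=> z Az /= Atz; exists z, (t - z); split => //; rewrite addrC subrK.
Qed.
End Gaps.

(** * Iterated truncated sums *)

Section StarSums.
Context {R : realType}.
Implicit Types (g h : nat -> R) (j n m N : nat) (l : seq nat).

Definition star_sum j g n : R := \sum_(1 <= m < n.+1) g m / m%:R ^+ j.

Definition star_iter l g : nat -> R := foldr star_sum g l.

Local Notation one := (fun=> 1 : R).
Local Notation idn := (fun m : nat => m%:R : R).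

Lemma star_sum0 j g : star_sum j g 0 = 0.
Proof. by rewrite /star_sum big_geq. Qed.

Lemma star_sumS j g n :
  star_sum j g n.+1 = star_sum j g n + g n.+1 / n.+1%:R ^+ j.
Proof. by rewrite /star_sum big_nat_recr. Qed.

Lemma star_iter_cat l l' g : star_iter (l ++ l') g = star_iter l (star_iter l' g).
Proof. exact: foldr_cat. Qed.

Lemma le_star_sum j g h n : (forall m, (0 < m <= n)%N -> g m <= h m) ->
  star_sum j g n <= star_sum j h n.
Proof.
move=> gh; rewrite /star_sum !big_nat; apply: ler_sum => m mn.
by apply: ler_wpM2r; [rewrite invr_ge0 exprn_ge0|apply: gh].
Qed.

Lemma le_star_iter l g h n : (0 < n)%N ->
  (forall m, (0 < m <= n)%N -> g m <= h m) -> star_iter l g n <= star_iter l h n.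
Proof.
elim: l n => [|j l IH] n n0 gh /=; first by apply: gh; rewrite n0 /=.
apply: le_star_sum => m /andP[m0 mn]; apply: IH => // i /andP[i0 im].
by apply: gh; rewrite i0 (leq_trans im).
Qed.

Lemma eq_star_iter l g h n : (0 < n)%N ->
  (forall m, (0 < m <= n)%N -> g m = h m) -> star_iter l g n = star_iter l h n.
Proof.
by move=> n0 gh; apply/eqP; rewrite eq_le !le_star_iter// => m /gh ->.
Qed.

Lemma star_sum_ge0 j g n : (forall m, (0 < m <= n)%N -> 0 <= g m) -> 0 <= star_sum j g n.
Proof.
move=> g0; rewrite /star_sum big_nat; apply: sumr_ge0 => m mn.
by rewrite mulr_ge0 ?g0// invr_ge0 exprn_ge0.
Qed.

Lemma star_iter_ge0 l g n : (0 < n)%N ->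
  (forall m, (0 < m <= n)%N -> 0 <= g m) -> 0 <= star_iter l g n.
Proof.
elim: l n => [|j l IH] n n0 g0 /=; first by apply: g0; rewrite n0 /=.
apply: star_sum_ge0 => m /andP[m0 mn]; apply: IH => // i /andP[i0 im].
by apply: g0; rewrite i0 (leq_trans im).
Qed.

Lemma star_iter_lin l a b g h n :
  star_iter l (fun m => a * g m + b * h m) n =
  a * star_iter l g n + b * star_iter l h n.
Proof.
elim: l n => [//|j l IH] n /=; rewrite /star_sum !mulr_sumr -big_split /=.
by apply: eq_bigr => m _; rewrite IH; ring.
Qed.

Lemma star_iterB l g h n :
  star_iter l (fun m => g m - h m) n = star_iter l g n - star_iter l h n.
Proof.
have := star_iter_lin l 1 (-1) g h n; rewrite mul1r mulN1r => <-.
by congr (star_iter l _ n); apply/funext => m; rewrite mul1r mulN1r.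
Qed.

Lemma star_iterZ l a g n : star_iter l (fun m => a * g m) n = a * star_iter l g n.
Proof.
have := star_iter_lin l a 0 g g n; rewrite mul0r addr0 => <-.
by congr (star_iter l _ n); apply/funext => m; rewrite mul0r addr0.
Qed.

Lemma star_sum_exp i j g n : (i <= j)%N ->
  (forall m, (0 < m <= n)%N -> 0 <= g m) -> star_sum j g n <= star_sum i g n.
Proof.
move=> ij g0; rewrite /star_sum !big_nat; apply: ler_sum => m mn.
have m1 : 1 <= m%:R :> R by rewrite ler1n; case/andP: mn.
by rewrite ler_wpM2l ?g0// lef_pV2 ?posrE ?exprn_gt0 ?(lt_le_trans ltr01)// ler_weXn2l.
Qed.

(** Consecutive cylinders abut: a last exponent j + 1 followed by 1, 1, ...
    contributes exactly as much as a last exponent j that is not followed by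
    anything. *)
Lemma star_sum_succ_id j n : star_sum j.+1 idn n = star_sum j one n.
Proof.
rewrite /star_sum !big_nat; apply: eq_bigr => m /andP[m0 _].
have m0' : m%:R != 0 :> R by rewrite pnatr_eq0 -lt0n.
by rewrite exprS invfM mulrA divff.
Qed.

Lemma star_sum1_id n : star_sum 1 idn n = n%:R.
Proof.
rewrite star_sum_succ_id /star_sum big_nat (eq_bigr (fun=> 1)); last first.
  by move=> m _; rewrite expr0 divr1.
by rewrite -big_nat sumr_const_nat subn1.
Qed.

Lemma star_sum_ge1 j g n : (0 < n)%N -> (forall m, (0 < m <= n)%N -> 1 <= g m) ->
  1 <= star_sum j g n.
Proof.
move=> n0 g1; rewrite /star_sum big_ltn// expr1n divr1.
have := g1 1%N; rewrite n0 => /(_ isT) h1.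
rewrite (le_trans h1)// lerDl big_nat; apply: sumr_ge0 => m /andP[m1 mn].
by rewrite mulr_ge0 ?invr_ge0 ?exprn_ge0// (le_trans ler01)// g1// (ltnW m1).
Qed.

Lemma star_iter_ge1 l g n : (0 < n)%N ->
  (forall m, (0 < m <= n)%N -> 1 <= g m) -> 1 <= star_iter l g n.
Proof.
elim: l n => [|j l IH] n n0 g0 /=; first by apply: g0; rewrite n0 /=.
apply: star_sum_ge1 => // m /andP[m0 mn]; apply: IH => // i /andP[i0 im].
by apply: g0; rewrite i0 (leq_trans im).
Qed.

Lemma star_iter_le_id l g n : all (ltn 0) l -> (0 < n)%N ->
  (forall m, (0 < m <= n)%N -> 0 <= g m <= m%:R) -> star_iter l g n <= n%:R.
Proof.
move=> + n0 gid; elim: l n n0 gid => [|j l IH] n n0 gid /=.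
  by move=> _; have := gid n; rewrite n0 leqnn => /(_ isT)/andP[].
move=> /andP[j0 lp]; rewrite -[leRHS]star_sum1_id.
have sg m i : (0 < m <= n)%N -> (0 < i <= m)%N -> 0 <= g i <= i%:R.
  by move=> /andP[m0 mn] /andP[i0 im]; apply: gid; rewrite i0 (leq_trans im).
have s0 m : (0 < m <= n)%N -> 0 <= star_iter l g m.
  move=> mn; have /andP[m0 _] := mn.
  by apply: star_iter_ge0 => // i im; have /andP[] := sg m i mn im.
apply: (le_trans (star_sum_exp j0 s0)).
apply: le_star_sum => m mn; have /andP[m0 _] := mn.
by apply: IH => // i; exact: sg.
Qed.

Lemma star_iter_nondecr j l g : (forall m, (0 < m)%N -> 0 <= g m) ->
  {homo star_iter (j :: l) g : m n / (m <= n)%N >-> m <= n}.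
Proof.
move=> g0; apply: homo_leq => [//|n m p|n /=]; first exact: le_trans.
rewrite star_sumS lerDl divr_ge0 ?exprn_ge0//.
by apply: star_iter_ge0 => // i /andP[i0 _]; exact: g0.
Qed.

(** The lexicographic order is reversed by the sums: at the first place where two
    indices differ, the one with the larger exponent gives less, whatever
    comes next.  Comparing id on one side with 1 on the other says that even
    the largest continuation of one index stays below the smallest of the
    other. *)
Lemma star_iter_cmp l l' : all (ltn 0) l -> all (ltn 0) l' ->
  [\/ prefix l l', prefix l' l,
      forall n, (0 < n)%N -> star_iter l idn n <= star_iter l' one n |
      forall n, (0 < n)%N -> star_iter l' idn n <= star_iter l one n].
Proof.
have key j l1 j' l2 : all (ltn 0) l1 -> (0 < j' < j)%N -> forall n, (0 < n)%N ->
    star_iter (j :: l1) idn n <= star_iter (j' :: l2) one n.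
  move=> l1p /andP[j'0]; case: j => // j j'j n n0 /=.
  apply: (@le_trans _ _ (star_sum j.+1 idn n)).
    apply: le_star_sum => m /andP[m0 _]; apply: star_iter_le_id => // i _.
    by rewrite ler0n lexx.
  rewrite star_sum_succ_id (le_trans (@star_sum_exp j' j _ _ j'j _))//.
  by apply: le_star_sum => m /andP[m0 _]; apply: star_iter_ge1.
elim: l l' => [|j l IH] [|j' l'] /=; try by constructor.
move=> /andP[j0 lp] /andP[j'0 lp'].
case: (ltngtP j j') => jj'.
- by apply: Or44; apply: key => //; rewrite j0.
- by apply: Or43; apply: key => //; rewrite j'0.
rewrite -jj' ?eqxx /=; have [H|H|H|H] := IH l' lp lp'.
- exact: Or41.
- exact: Or42.
- by apply: Or43 => n n0; apply: le_star_sum => m /andP[m0 _]; exact: H.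
- by apply: Or44 => n n0; apply: le_star_sum => m /andP[m0 _]; exact: H.
Qed.

(** On functions vanishing at 1, each S_j with j >= 1 contracts, with respect to the weight
    m - 1, by the factor 1 - 1/n on [1, n]; hence the choice of the innermost
    function becomes immaterial as the length of the index grows. *)
Lemma star_iter_contract l g n : all (ltn 0) l -> (0 < n)%N ->
  (forall m, (0 < m <= n)%N -> 0 <= g m <= m%:R - 1) ->
  star_iter l g n <= (1 - n%:R^-1) ^+ size l * (n%:R - 1).
Proof.
move=> lp n0 hg.
pose c : R := 1 - n%:R^-1.
have n1 : 1 <= n%:R :> R by rewrite ler1n.
have ngt0 : 0 < n%:R :> R by rewrite ltr0n.
have c0 : 0 <= c by rewrite subr_ge0 invf_le1.
suff H m : (0 < m <= n)%N -> 0 <= star_iter l g m <= c ^+ size l * (m%:R - 1).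
  by have /andP[] : 0 <= star_iter l g n <= c ^+ size l * (n%:R - 1) by apply: H; rewrite n0 /=.
elim: l lp m => [_ m mn|j l IH /= /andP[j0 lp] m /andP[m0 mn]].
  by rewrite expr0 mul1r hg.
have IH' i : (0 < i <= m)%N -> 0 <= star_iter l g i <= c ^+ size l * (i%:R - 1).
  by move=> /andP[i0 im]; apply: IH; rewrite // i0 (leq_trans im).
apply/andP; split; first by apply: star_sum_ge0 => i /IH' /andP[].
apply: (@le_trans _ _ (star_sum 1 (star_iter l g) m)).
  by apply: star_sum_exp => // i /IH' /andP[].
elim: m m0 mn {IH} IH' => [//|m IHm] _ mn IH'.
rewrite star_sumS; have [->|m0] := posnP m.
  rewrite star_sum0 add0r subrr mulr0 expr1 divr1.
  have := IH' 1%N; rewrite subrr mulr0 => /(_ isT)/andP[].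
  by [].
have IH2 : star_sum 1 (star_iter l g) m <= c ^+ (size l).+1 * (m%:R - 1).
  by apply: IHm => // [|i /andP[i0 im]]; [exact: ltnW|apply: IH'; rewrite i0 ltnW].
have /andP[_ h] : 0 <= star_iter l g m.+1 <= c ^+ size l * (m.+1%:R - 1).
  by apply: IH'; rewrite /= leqnn.
have mp : 0 < m.+1%:R :> R by rewrite ltr0n.
have h2 : star_iter l g m.+1 / m.+1%:R ^+ 1 <= c ^+ (size l).+1.
  rewrite expr1 ler_pdivrMr// (le_trans h)// exprSr -mulrA ler_wpM2l ?exprn_ge0//.
  rewrite /c mulrBl mul1r lerB// mulrC ler_pdivrMr// mul1r.
  by rewrite ler_nat.
rewrite (le_trans (lerD IH2 h2))//.
by rewrite -[X in _ + X]mulr1 -mulrDr -natr1; apply: ler_wpM2l; [rewrite exprn_ge0|lra].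
Qed.

End StarSums.

(** * The truncated product, which is the fixed point of S_q *)

Section MinimalTail.
Context {R : realType} (q : nat).
Context (hq : (2 <= q)%N).
Implicit Types (g h : nat -> R) (j n m N : nat) (l : seq nat).
Local Notation one := (fun=> 1 : R).
Local Notation idn := (fun m : nat => m%:R : R).

(** The product is written with the factors 1 / (1 - 1 / i ^+ q) because its
    limit is then literally the infinite product of the theorem. *)
Definition eprod n : R := \prod_(2 <= i < n.+1) (1 / (1 - 1 / i%:R ^+ q)).

Lemma eprod1 : eprod 1 = 1.
Proof. by rewrite /eprod big_geq. Qed.

Lemma eprodS n : (0 < n)%N -> eprod n.+1 = eprod n * (1 / (1 - 1 / n.+1%:R ^+ q)).
Proof. by move=> n0; rewrite /eprod big_nat_recr. Qed.

Lemma euler_factor_gt0 n : (1 < n)%N -> 0 < 1 - 1 / n%:R ^+ q :> R.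
Proof.
move=> n1; rewrite subr_gt0 div1r invf_lt1 ?exprn_gt0 ?ltr0n ?(ltnW n1)//.
by rewrite exprn_egt1 ?ltr1n// -lt0n ltnW.
Qed.

Lemma eprod_ge1 n : 1 <= eprod n.
Proof.
rewrite /eprod big_nat; elim/big_ind: _ => [//|x y x1 y1|i /andP[i1 _]].
  by rewrite (le_trans x1)// ler_peMr// (le_trans ler01).
rewrite ler_pdivlMr ?euler_factor_gt0// mul1r gerBl.
Qed.

Lemma eprod_gt0 n : 0 < eprod n.
Proof. exact: lt_le_trans ltr01 (eprod_ge1 n). Qed.

(** The difference P(n+1) - P(n) is P(n+1) / (n+1)^q by the shape of the last
    factor. *)
Lemma star_sum_eprod n : (0 < n)%N -> star_sum q eprod n = eprod n.
Proof.
elim: n => // -[|n] IH _.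
  by rewrite star_sumS star_sum0 add0r eprod1 expr1n divr1.
rewrite star_sumS IH// !(@eprodS n.+1)//.
have := euler_factor_gt0 (isT : (1 < n.+2)%N); set x := _ ^+ q => h.
have x0 : x != 0 by rewrite expf_neq0// pnatr_eq0.
have h' : x - 1 != 0.
  apply: contraTneq h => /eqP; rewrite subr_eq0 => /eqP ->.
  by rewrite divr1 subrr ltxx.
by field; rewrite x0 h'.
Qed.

(** The product decreases with q, and for q = 2 it telescopes to
    2 n / (n + 1). *)
Lemma eprod_le n : (0 < n)%N -> eprod n <= 2 * n%:R / (n%:R + 1).
Proof.
elim: n => // -[|n] IH _.
  by rewrite eprod1 mulr1 divff// (natrD _ 1 1) pnatr_eq0.
rewrite eprodS//; set k : R := n.+1%:R.
have k1 : 1 <= k by rewrite ler1n.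
have -> : n.+2%:R = k + 1 :> R by rewrite natr1.
apply: (@le_trans _ _ ((2 * k / (k + 1)) * (1 / (1 - 1 / (k + 1) ^+ 2)))).
  apply: ler_pM; rewrite ?(ltW (eprod_gt0 _)) ?IH//.
    have := euler_factor_gt0 (isT : (1 < n.+2)%N).
    by rewrite -natr1 -/k => /ltW h; rewrite divr_ge0.
  have h2 : 0 < 1 - 1 / (k + 1) ^+ 2.
    by rewrite subr_gt0 div1r invf_lt1 ?exprn_gt0 ?exprn_egt1//; lra.
  have le : 1 / (k + 1) ^+ q <= 1 / (k + 1) ^+ 2.
    rewrite !div1r lef_pV2 ?posrE ?exprn_gt0//; try lra.
    by rewrite ler_weXn2l//; lra.
  by rewrite !div1r lef_pV2 ?posrE//; lra.
rewrite le_eqVlt; apply/orP; left; apply/eqP.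
by field; rewrite ?lt0r_neq0//; nra.
Qed.

(** Source of the comparison of a gap with the set below it. *)
Lemma eprod_add_div_le2 n : (0 < n)%N -> eprod n + eprod n / n%:R <= 2.
Proof.
move=> n0; have k0 : 0 < n%:R :> R by rewrite ltr0n.
have -> : eprod n + eprod n / n%:R = eprod n * ((n%:R + 1) / n%:R) by field; lra.
rewrite -ler_pdivlMr; last by rewrite divr_gt0//; lra.
rewrite (le_trans (eprod_le n0))// le_eqVlt; apply/orP; left; apply/eqP.
by field; apply/andP; split; lra.
Qed.

Lemma eprod_le2 n : (0 < n)%N -> eprod n <= 2.
Proof.
move=> n0; rewrite (le_trans _ (eprod_add_div_le2 n0))// lerDl divr_ge0//.
exact/ltW/eprod_gt0.
Qed.

(** Source of the comparison of a gap with the cylinder above it on a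
    logarithmic scale. *)
Lemma eprod_sqr_le n : (0 < n)%N -> eprod n ^+ 2 <= n%:R.
Proof.
move=> n0; have k1 : 1 <= n%:R :> R by rewrite ler1n.
apply: (@le_trans _ _ ((2 * n%:R / (n%:R + 1)) ^+ 2)).
  by rewrite lerXn2r ?nnegrE ?eprod_le// ?ltW ?eprod_gt0// divr_ge0//; lra.
have kp : 0 < n%:R + 1 :> R by lra.
rewrite expr_div_n ler_pdivrMr ?exprn_gt0//.
by have := mulr_ge0 (ler0n R n) (sqr_ge0 (n%:R - 1 : R)); nra.
Qed.

Lemma eprod_le_id n : (0 < n)%N -> eprod n <= n%:R.
Proof.
move=> n0; rewrite (le_trans _ (eprod_sqr_le n0))// expr2 ler_peMr ?eprod_ge1//.
exact/ltW/eprod_gt0.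
Qed.

Lemma eprod_le_iter l n : all (leq^~ q) l -> (0 < n)%N ->
  eprod n <= star_iter l eprod n.
Proof.
elim: l n => [//|j l IH] n /= /andP[jq lq] n0.
rewrite -[leLHS]star_sum_eprod//.
apply: (@le_trans _ _ (star_sum j eprod n)).
  by apply: star_sum_exp => // m _; exact/ltW/eprod_gt0.
by apply: le_star_sum => m /andP[m0 _]; exact: IH.
Qed.

(** Cauchy-Schwarz for the positive functional g |-> star_iter l g n, applied to
    1 and P, followed by P^2 <= id. *)
Lemma star_iter_eprod_sqr l n : (0 < n)%N ->
  star_iter l eprod n ^+ 2 <= star_iter l one n * star_iter l idn n.
Proof.
move=> n0; set a := star_iter l eprod n; set b := star_iter l one n.
have b0 : 0 < b by rewrite (lt_le_trans ltr01)// star_iter_ge1.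
(* the value of s for which the expanded square (P - s)^2 is optimal *)
pose s := a / b.
have h : star_iter l (fun m => 2 * s * eprod m + (- s ^+ 2) * 1) n <= star_iter l idn n.
  apply: le_star_iter => // m /andP[m0 _].
  by have := eprod_sqr_le m0; have := sqr_ge0 (eprod m - s); nra.
move: h; rewrite star_iter_lin -/a -/b => h.
have := ler_wpM2l (ltW b0) h; apply: le_trans.
by rewrite /s le_eqVlt; apply/orP; left; apply/eqP; field; lra.
Qed.

(** In the limit: the lower end of the cylinder of l, the left end and the right
    end of its gap of index j satisfy low + right <= 2 * left. *)
Lemma star_iter_split l j n : (j < q)%N -> (0 < n)%N ->
  star_iter l eprod n + star_iter (rcons l j) eprod n
    <= 2 * star_iter (rcons l j) one n.
Proof.
move=> jq n0; rewrite -!cats1 !star_iter_cat -star_iterZ.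
rewrite -[X in X + _]mul1r -[X in _ + X]mul1r -star_iter_lin.
apply: le_star_iter => // m /andP[m0 _]; rewrite !mul1r /=.
apply: (@le_trans _ _ (star_sum j.+1 eprod m + star_sum j eprod m)).
  rewrite lerD2r -[leLHS]star_sum_eprod//.
  by apply: star_sum_exp => // i _; exact/ltW/eprod_gt0.
rewrite /star_sum mulr_sumr -big_split /= !big_nat; apply: ler_sum => i /andP[i0 _].
have -> : eprod i / i%:R ^+ j.+1 + eprod i / i%:R ^+ j
          = (eprod i + eprod i / i%:R) / i%:R ^+ j.
  by rewrite mulrDl addrC exprS invfM mulrA.
by rewrite mul1r; apply: ler_wpM2r; rewrite ?invr_ge0 ?exprn_ge0// eprod_add_div_le2.
Qed.

End MinimalTail.

(** * Truncations of multiple zeta-star values *)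

Section EsumLink.
Context {R : realType}.
Implicit Types (j m N : nat) (l : seq nat).
Local Notation one := (fun=> 1 : R).

Definition star_term l (t : (size l).-tuple nat) : R :=
  \prod_(i < size l) ((tnth t i)%:R ^+ nth 0%N l i)^-1.

Lemma star_term_ge0 l t : 0 <= @star_term l t.
Proof. by apply: prodr_ge0 => i _; rewrite invr_ge0 exprn_ge0. Qed.

Definition star_dom_le r N : set (r.-tuple nat) :=
  @star_dom r `&` [set t | all (leq^~ N) t].

(** Splitting off the largest index n_1 = m leaves a nonincreasing tuple bounded
    by m: this is the recursion of [star_iter]. *)
Lemma star_dom_le_cons r N m (t : r.-tuple nat) :
  star_dom_le N [tuple of m :: t] <-> (0 < m <= N)%N /\ star_dom_le m t.
Proof.
split.
- move=> [[/= s p] /= /andP[mN aN]].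
  move: s; rewrite (path_sortedE (fun a b c h1 h2 => leq_trans h2 h1)) => /andP[am st].
  split; first by rewrite mN andbT; have := p ord0; rewrite tnth0.
  split; first by split => // i; have := p (lift ord0 i); rewrite tnthS.
  by apply: sub_all am => x.
- move=> [/andP[m0 mN] [[st p] am]]; split; last first.
    by rewrite /= mN; apply: sub_all am => x /leq_trans; apply.
  split.
    rewrite /= (path_sortedE (fun a b c h1 h2 => leq_trans h2 h1)) st andbT.
    by apply: sub_all am => x.
  by move=> i; case: (unliftP ord0 i) => [k|] ->; rewrite ?tnthS ?tnth0.
Qed.

Lemma star_term_cons j l m (t : (size l).-tuple nat) :
  @star_term (j :: l) [tuple of m :: t] = (m%:R ^+ j)^-1 * star_term t.
Proof.
rewrite /star_term big_ord_recl tnth0; congr (_ * _).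
by apply: eq_bigr => i _; rewrite tnthS.
Qed.

(** The factor c absorbs the powers of the indices already split off, so the
    induction needs no rule for pulling constants out of unordered sums. *)
Lemma esum_star_dom_le_scaled l (c : R) N : 0 <= c -> (0 < N)%N ->
  (\esum_(t in star_dom_le N) (c * @star_term l t)%:E)%E
  = (c * star_iter l one N)%:E.
Proof.
elim: l c N => [|j l IH] c N c0 N0.
  have -> : star_dom_le N = [set [tuple]] :> set ((size (@nil nat)).-tuple nat).
    apply/seteqP; split => t; rewrite (tuple0 t)// => _.
    by split => //; split => // -[].
  by rewrite esum_set1 ?lee_fin ?mulr_ge0 ?star_term_ge0// /star_term big_ord0.
pose e (p : nat * (size l).-tuple nat) : (size (j :: l)).-tuple nat := [tuple of p.1 :: p.2].
rewrite (reindex_esum ([set m | (0 < m <= N)%N] `*`` (@star_dom_le (size l))) _ e); last first.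
  split.
  - by move=> [m t] /= [? ?]; apply/star_dom_le_cons.
  - move=> [m t] [m' t'] _ _ /(congr1 val) /= [-> tt'].
    by congr (_, _); apply: val_inj.
  - move=> t; case/tupleP: t => m t /star_dom_le_cons h.
    by exists (m, t).
under eq_esum do rewrite star_term_cons mulrA.
have cm m : 0 <= c * (m%:R ^+ j)^-1 by rewrite mulr_ge0// invr_ge0 exprn_ge0.
rewrite -(@esum_esum _ _ _ _ _ (fun m t => (c * (m%:R ^+ j)^-1 * @star_term l t)%:E)); last first.
  by move=> m t _ _; rewrite lee_fin mulr_ge0 ?star_term_ge0.
rewrite (@eq_esum _ _ _ _ (fun m => (c * (star_iter l one m / m%:R ^+ j))%:E)); last first.
  by move=> m /andP[m0 mN]; rewrite IH// mulrAC -mulrA.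
have -> : [set m | (0 < m <= N)%N] = [set` index_iota 1 N.+1].
  by apply/seteqP; split => m /=; rewrite mem_index_iota ltnS.
have t0 m : 0 <= c * (star_iter l one m / m%:R ^+ j).
  rewrite mulr_ge0// divr_ge0 ?exprn_ge0//.
  case: m => [|m]; last exact: star_iter_ge0.
  by case: l {IH e} => [|i l] /=; rewrite ?ler01// star_sum0.
rewrite esum_fset; [|exact: finite_seq|by move=> m _; rewrite lee_fin].
by rewrite -fsbig_seq ?iota_uniq//= sumEFin -mulr_sumr.
Qed.

Lemma esum_star_dom_le l N : (0 < N)%N ->
  (\esum_(t in star_dom_le N) (@star_term l t)%:E)%E = (star_iter l one N)%:E.
Proof.
move=> N0; rewrite -[star_iter _ _ _]mul1r -(@esum_star_dom_le_scaled l 1)//.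
by apply: eq_esum => t _; rewrite mul1r.
Qed.

(** A finite set of tuples has bounded entries, so its sum is below one of the
    truncations. *)
Lemma esum_star_dom l (e : R) : (forall N, (0 < N)%N -> star_iter l one N <= e) ->
  (\esum_(t in @star_dom (size l)) (@star_term l t)%:E <= e%:E)%E.
Proof.
move=> le; apply: ge_ereal_sup => _ /= [X [finX Xs] <-].
pose N := (\max_(t <- finmap.enum_fset (fset_set X)) \max_(m <- tval t) m).+1.
have XN : X `<=` @star_dom_le (size l) N.
  move=> t Xt; split; first exact: Xs.
  apply/allP => m mt; rewrite /N; apply/leqW.
  apply: (@leq_trans (\max_(i <- tval t) i)); first exact: (@leq_bigmax_seq _ _ predT (fun i => i)).
  by apply: (@leq_bigmax_seq _ _ predT
    (fun t : (size l).-tuple nat => \max_(i <- tval t) i)) => //; rewrite in_fset_set// inE.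
apply: (@le_trans _ _ (star_iter l one N)%:E); last by rewrite lee_fin le.
by rewrite -esum_star_dom_le//; apply: ereal_sup_ubound; exists X.
Qed.

Lemma zeta_star_ge_iter l (e : R) N : (forall N, (0 < N)%N -> star_iter l one N <= e) ->
  (0 < N)%N -> star_iter l one N <= zeta_star R l <= e.
Proof.
move=> le N0.
have h1 := esum_star_dom le.
have h2 : ((star_iter l one N)%:E <= \esum_(t in @star_dom (size l)) (@star_term l t)%:E)%E.
  rewrite -esum_star_dom_le//; apply: ereal_sup_le => _ /= [X [fX Xs] <-].
  by exists X => //; split => // t /Xs [].
have fin : (\esum_(t in @star_dom (size l)) (@star_term l t)%:E \is a fin_num)%E.
  by rewrite fin_numE; apply/andP; split; apply/eqP => E; move: h1 h2; rewrite E.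
by move: h1 h2; rewrite /zeta_star -(fineK fin) !lee_fin => -> ->.
Qed.
End EsumLink.

(** * Infinite indices *)

Section LimitFunctions.
Context {R : realType}.
Implicit Types (g h : nat -> R) (j n m N r : nat) (l : seq nat) (k : nat -> nat).
Local Notation one := (fun=> 1 : R).
Local Notation idn := (fun m : nat => m%:R : R).

Lemma cvgn_to_ge (u : nat -> R) (a b : R) r0 : u @ \oo --> b ->
  (forall r, (r0 <= r)%N -> a <= u r) -> a <= b.
Proof.
move=> ub h; rewrite -(cvg_lim _ ub)//; apply: limr_ge.
  by apply/cvg_ex; exists b.
by exists r0 => // r /= /h.
Qed.

Lemma cvgn_to_le (u : nat -> R) (a b : R) r0 : u @ \oo --> b ->
  (forall r, (r0 <= r)%N -> u r <= a) -> b <= a.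
Proof.
move=> ub h; rewrite -(cvg_lim _ ub)//; apply: limr_le.
  by apply/cvg_ex; exists b.
by exists r0 => // r /= /h.
Qed.

Lemma ler_cvgn (u v : nat -> R) (a b : R) : u @ \oo --> a -> v @ \oo --> b ->
  (forall n, u n <= v n) -> a <= b.
Proof. by move=> ua vb uv; apply: ler_cvg_to ua vb _; exact: nearW. Qed.

Lemma nondecreasing_bounded_cvgn (u : nat -> R) (e : R) :
  nondecreasing_seq u -> (forall n, u n <= e) ->
  exists2 l, u @ \oo --> l & (forall n, u n <= l) /\ l <= e.
Proof.
move=> nd ue; have ub : has_ubound (range u) by exists e => _ [n _ <-].
exists (sup (range u)); first exact: nondecreasing_cvgn.
split; first by move=> n; apply: sup_upper_bound; [split=> //; exists (u 0%N), 0%N|exists n].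
by apply: ge_sup; [exists (u 0%N), 0%N|move=> _ [n _ <-]].
Qed.

(** The truncation at n_1 <= n of zeta-star at the infinite index k. *)
Definition star_fun k n : R := limn (fun r => star_iter (mkseq k r) one n).

Lemma all_mkseq_pos k r : (forall i, (0 < k i)%N) -> all (ltn 0) (mkseq k r).
Proof. by move=> k0; apply/allP => j /mapP[i _ ->]; exact: k0. Qed.

Lemma all_mkseq_le q k r : (forall i, (k i <= q)%N) -> all (leq^~ q) (mkseq k r).
Proof. by move=> kq; apply/allP => j /mapP[i _ ->]; exact: kq. Qed.

Lemma mkseq_add k r s : mkseq k (r + s) = mkseq k r ++ mkseq (fun i => k (r + i)%N) s.
Proof.
rewrite /mkseq iotaD map_cat; congr (_ ++ _).
by rewrite add0n -{1}[r]addn0 iotaDl -map_comp.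
Qed.

Lemma mkseq_nth_cat d l s : mkseq (nth d l) (size l + s) = l ++ nseq s d.
Proof.
rewrite mkseq_add mkseq_nth; congr (_ ++ _).
apply: (@eq_from_nth _ d); rewrite ?size_mkseq ?size_nseq// => i is_.
by rewrite nth_mkseq// nth_nseq is_ nth_default// leq_addr.
Qed.

Lemma star_iter_one_nondecr k n : (0 < n)%N ->
  nondecreasing_seq (fun r => star_iter (mkseq k r) one n).
Proof.
move=> n0; apply/nondecreasing_seqP => r.
rewrite -addn1 mkseq_add star_iter_cat; apply: le_star_iter => // m /andP[m0 _].
exact: star_iter_ge1.
Qed.

Section PositiveIndex.
Context (k : nat -> nat) (k0 : forall i, (0 < k i)%N).

(** By [star_iter_contract] any innermost function between 1 and id leads to the
    same limit.  Taking g = id, or g = P, turns the limit into bounds and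
    into closed formulas for indices that are eventually 1, or eventually
    q. *)
Lemma star_fun_cvg g n : (0 < n)%N -> (forall m, (0 < m)%N -> 1 <= g m <= m%:R) ->
  (fun r => star_iter (mkseq k r) g n) @ \oo --> star_fun k n.
Proof.
move=> n0 hg.
have le_n r : star_iter (mkseq k r) one n <= n%:R.
  apply: star_iter_le_id => // [|m /andP[m0 _]]; first exact: all_mkseq_pos.
  by rewrite ler01 ler1n.
have [l ul _] := nondecreasing_bounded_cvgn (star_iter_one_nondecr k n0) le_n.
rewrite /star_fun (cvg_lim _ ul)//.
have n1 : 1 <= n%:R :> R by rewrite ler1n.
have ngt0 : 0 < n%:R :> R by rewrite ltr0n.
have geo : (fun r => (1 - n%:R^-1) ^+ r * (n%:R - 1) : R) @ \oo --> 0.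
  rewrite -[X in _ --> X](mul0r (n%:R - 1)); apply: cvgM; last exact: cvg_cst.
  apply: cvg_expr; rewrite ger0_norm; last by rewrite subr_ge0 invf_le1.
  by rewrite ltrBlDr ltrDl invr_gt0.
rewrite -[l]add0r; have -> : (fun r => star_iter (mkseq k r) g n) =
   (fun r => star_iter (mkseq k r) (fun m => g m - 1) n) \+ (fun r => star_iter (mkseq k r) one n).
  by apply/funext => r /=; rewrite star_iterB subrK.
apply: cvgD => //.
apply: (squeeze_cvgr _ (cvg_cst 0) geo); apply: nearW => r; apply/andP; split.
  by apply: star_iter_ge0 => // m /andP[m0 _]; have := hg m m0; lra.
rewrite -{2}(size_mkseq k r); apply: star_iter_contract => //; first exact: all_mkseq_pos.
by move=> m /andP[m0 _]; have := hg m m0; lra.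
Qed.

Lemma star_iter_le_fun r n : (0 < n)%N -> star_iter (mkseq k r) one n <= star_fun k n.
Proof.
move=> n0; have hc : (fun r => star_iter (mkseq k r) one n) @ \oo --> star_fun k n.
  by apply: star_fun_cvg => // m m0; rewrite lexx ler1n.
apply: (@cvgn_to_ge _ _ _ r hc) => s rs; exact: star_iter_one_nondecr.
Qed.

Lemma star_fun_le_iter r n : (0 < n)%N -> star_fun k n <= star_iter (mkseq k r) idn n.
Proof.
move=> n0; have hc : (fun r => star_iter (mkseq k r) idn n) @ \oo --> star_fun k n.
  by apply: star_fun_cvg => // m m0; rewrite lexx ler1n m0.
apply: (@cvgn_to_le _ _ _ r hc) => s /subnKC <-.
rewrite mkseq_add star_iter_cat; apply: le_star_iter => // m /andP[m0 _].
apply: star_iter_le_id => //; first exact: all_mkseq_pos.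
by move=> i _; rewrite ler0n lexx.
Qed.

Lemma star_fun_nondecr n m : (0 < n <= m)%N -> star_fun k n <= star_fun k m.
Proof.
move=> /andP[n0 nm]; have m0 : (0 < m)%N by exact: leq_trans nm.
have hc : (fun r => star_iter (mkseq k r) one n) @ \oo --> star_fun k n.
  by apply: star_fun_cvg => // i i0; rewrite lexx ler1n.
apply: (@cvgn_to_le _ _ _ 1 hc) => -[//|r] _.
apply: le_trans (star_iter_le_fun r.+1 m0).
by apply: star_iter_nondecr => //= i _; exact: ler01.
Qed.

Lemma star_fun_ge1 n : (0 < n)%N -> 1 <= star_fun k n.
Proof. exact: (star_iter_le_fun 0). Qed.

(** The limits in the length of the index and in the truncation commute, since
    everything is monotone in both. *)
Lemma eta_star_cvg (e : R) : (forall n, (0 < n)%N -> star_fun k n <= e) ->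
  (fun n => star_fun k n.+1) @ \oo --> eta_star R k.
Proof.
move=> fe.
have nd : nondecreasing_seq (fun n => star_fun k n.+1).
  by move=> m n mn; apply: star_fun_nondecr; rewrite ltnS.
have [c hc [fc _]] := @nondecreasing_bounded_cvgn _ e nd (fun n => fe n.+1 isT).
suff -> : eta_star R k = c by [].
apply: cvg_lim => //.
have le r N : (0 < N)%N -> star_iter (mkseq k r) one N <= c.
  by case: N => // N _; exact: le_trans (star_iter_le_fun _ _) (fc N).
apply/cvgrPdist_lt => eps eps0.
have [N _ /(_ N (leqnn N)) hN] : \forall n \near \oo, `|c - star_fun k n.+1| < eps / 2.
  by move/cvgrPdist_lt: hc; apply; rewrite divr_gt0.
have cN : (fun r => star_iter (mkseq k r) one N.+1) @ \oo --> star_fun k N.+1.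
  by apply: star_fun_cvg => // m m0; rewrite lexx ler1n.
have [r0 _ hr] : \forall r \near \oo, `|star_fun k N.+1 - star_iter (mkseq k r) one N.+1| < eps / 2.
  by move/cvgrPdist_lt: cN; apply; rewrite divr_gt0.
exists r0 => // r /= /hr h; have /andP[h1 h2] := zeta_star_ge_iter (le r) (isT : (0 < N.+1)%N).
move: hN h; rewrite !ltr_norml => /andP[_ ?] /andP[_ ?]; apply/andP; split; lra.
Qed.

Lemma eta_star_le (e : R) : (forall n, (0 < n)%N -> star_fun k n <= e) ->
  eta_star R k <= e.
Proof. by move=> fe; apply: (cvgn_to_le (r0 := 0) (eta_star_cvg fe)) => r _; exact: fe. Qed.

Lemma eta_star_ge (e : R) n : (forall n, (0 < n)%N -> star_fun k n <= e) ->
  (0 < n)%N -> star_fun k n <= eta_star R k.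
Proof.
move=> fe; case: n => // n _; apply: (cvgn_to_ge (r0 := n) (eta_star_cvg fe)) => r nr.
by apply: star_fun_nondecr; rewrite ltnS.
Qed.
End PositiveIndex.

Lemma star_fun_nth1 l n : all (ltn 0) l -> (0 < n)%N ->
  star_fun (nth 1%N l) n = star_iter l idn n.
Proof.
move=> lp n0.
have k0 i : (0 < nth 1%N l i)%N
  by have [il|il] := ltnP i (size l); [exact: (all_nthP _ lp)|rewrite nth_default].
have hc : (fun r => star_iter (mkseq (nth 1%N l) r) idn n) @ \oo --> star_fun (nth 1%N l) n.
  by apply: star_fun_cvg => // m m0; rewrite lexx ler1n m0.
have E r : (size l <= r)%N -> star_iter (mkseq (nth 1%N l) r) idn n = star_iter l idn n.
  move=> /subnKC <-; rewrite mkseq_nth_cat star_iter_cat.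
  apply: eq_star_iter => // m _; elim: (_ - _)%N m => //= s IH m.
  by rewrite -[RHS]star_sum1_id /star_sum; apply: eq_bigr => i _; rewrite IH.
apply/eqP; rewrite eq_le (cvgn_to_le (r0 := size l) hc).
  by rewrite (cvgn_to_ge (r0 := size l) hc)// => r /E ->.
by move=> r /E ->.
Qed.

Lemma star_fun_nthq q l n : (2 <= q)%N -> all (ltn 0) l -> (0 < n)%N ->
  star_fun (nth q l) n = star_iter l (eprod q) n.
Proof.
move=> q2 lp n0.
have k0 i : (0 < nth q l i)%N.
  by have [il|il] := ltnP i (size l); [exact: (all_nthP _ lp)|rewrite nth_default// ltnW].
have hc : (fun r => star_iter (mkseq (nth q l) r) (eprod q) n) @ \oo --> star_fun (nth q l) n.
  by apply: star_fun_cvg => // m m0; rewrite eprod_ge1// eprod_le_id.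
have E r : (size l <= r)%N -> star_iter (mkseq (nth q l) r) (eprod q) n = star_iter l (eprod q) n.
  move=> /subnKC <-; rewrite mkseq_nth_cat star_iter_cat.
  apply: eq_star_iter => // m /andP[m0 _]; elim: (_ - _)%N m m0 => //= s IH m m0.
  rewrite -[RHS](star_sum_eprod q2)// /star_sum !big_nat.
  by apply: eq_bigr => i /andP[i0 _]; rewrite IH.
apply/eqP; rewrite eq_le (cvgn_to_le (r0 := size l) hc).
  by rewrite (cvgn_to_ge (r0 := size l) hc)// => r /E ->.
by move=> r /E ->.
Qed.

Lemma star_fun_ge_iter_eprod q k r n : (2 <= q)%N -> (forall i, (0 < k i <= q)%N) ->
  (0 < n)%N -> star_iter (mkseq k r) (eprod q) n <= star_fun k n.
Proof.
move=> q2 kq n0; have k0 i : (0 < k i)%N by case/andP: (kq i).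
have hc : (fun r => star_iter (mkseq k r) (eprod q) n) @ \oo --> star_fun k n.
  by apply: star_fun_cvg => // m m0; rewrite eprod_ge1// eprod_le_id.
apply: (cvgn_to_ge (r0 := r) hc) => s /subnKC <-.
rewrite mkseq_add star_iter_cat; apply: le_star_iter => // m /andP[m0 _].
by apply: eprod_le_iter => //; apply: all_mkseq_le => i; case/andP: (kq (r + i)%N).
Qed.

End LimitFunctions.

(** * The indices (2, 1, ..., 1) *)

Section UnboundedCylinders.
Context {R : realType}.
Implicit Types (g h : nat -> R) (b j n m N : nat) (l : seq nat) (k : nat -> nat).
Local Notation one := (fun=> 1 : R).
Local Notation idn := (fun m : nat => m%:R : R).
Local Notation ge2 := (fun m : nat => (1 < m)%N%:R : R).

(** The weights 1 / (m (m - 1)), m >= 2, are invariant under the adjoint of S_1: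
    the tail sum of 1 / (i (i - 1)) over i >= m is 1 / (m - 1). *)
Definition tele_sum h n : R := \sum_(2 <= m < n.+1) h m / (m%:R * (m%:R - 1)).

Lemma tele_sumS h n : (0 < n)%N ->
  tele_sum h n.+1 = tele_sum h n + h n.+1 / (n.+1%:R * n%:R).
Proof. by move=> n0; rewrite /tele_sum big_nat_recr//= -[n.+1%:R]natr1 addrK. Qed.

Lemma tele_sum1 h : tele_sum h 1 = 0.
Proof. by rewrite /tele_sum big_geq. Qed.

Lemma le_tele_sum g h n : (forall m, (0 < m)%N -> g m <= h m) ->
  tele_sum g n <= tele_sum h n.
Proof.
move=> gh; rewrite /tele_sum !big_nat; apply: ler_sum => m /andP[m1 _].
apply: ler_wpM2r; last by apply: gh; exact: ltnW.
by rewrite invr_ge0 mulr_ge0// subr_ge0 ler1n ltnW.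
Qed.

(** The invariance for truncated sums, by Abel summation. *)
Lemma tele_sum_star_sum1 h n : h 1%N = 0 -> (0 < n)%N ->
  tele_sum (star_sum 1 h) n + star_sum 1 h n / n%:R = tele_sum h n.
Proof.
move=> h1; elim: n => // -[|n] IH _.
  by rewrite !tele_sum1 star_sumS star_sum0 h1 mul0r addr0 mul0r addr0.
rewrite !(@tele_sumS _ n.+1)// -IH// star_sumS expr1.
set k : R := n.+1%:R; have k1 : 1 <= k by rewrite ler1n.
by rewrite -(natr1 n.+1) -/k; field; apply/andP; split; lra.
Qed.

Lemma star_sum2_le_tele h n : h 1%N = 0 -> (forall m, (0 < m)%N -> 0 <= h m) ->
  (0 < n)%N -> star_sum 2 h n <= tele_sum h n.
Proof.
move=> h1 h0; elim: n => // -[|n] IH _.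
  by rewrite tele_sum1 star_sumS star_sum0 h1 mul0r addr0.
rewrite tele_sumS// star_sumS lerD ?IH// ler_wpM2l ?h0// expr2.
by rewrite lef_pV2 ?posrE ?mulr_gt0 ?ltr0n// ler_wpM2l// ler_nat.
Qed.

Lemma tele_sum_ge2 n : tele_sum ge2 n <= 1.
Proof.
case: n => [|n]; first by rewrite /tele_sum big_geq// ler01.
suff -> : tele_sum ge2 n.+1 = 1 - n.+1%:R^-1 by rewrite gerBl invr_ge0.
elim: n => [|n IH]; first by rewrite tele_sum1 invr1 subrr.
rewrite tele_sumS// IH/=; set k : R := n.+1%:R.
have k1 : 1 <= k by rewrite ler1n.
by rewrite -(natr1 n.+1) -/k; field; apply/andP; split; lra.
Qed.

Definition ones_prefix b : seq nat := 2%N :: nseq b 1%N.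

Lemma ones_prefix_rcons b : ones_prefix b.+1 = rcons (ones_prefix b) 1%N.
Proof. by rewrite /ones_prefix /= -cats1 -(nseqD b 1) addn1. Qed.

(** The weights m^(-2) of S_2 are at most the S_1-invariant ones, so the bound
    does not depend on the number of ones. *)
Lemma ones_prefix_le1 b h n : (forall m, (0 < m)%N -> 0 <= h m <= ge2 m) ->
  (0 < n)%N -> star_iter (ones_prefix b) h n <= 1.
Proof.
move=> hh n0.
have h1 : h 1%N = 0 by have := hh 1%N isT; rewrite /= -eq_le => /eqP.
have it0 c m : (0 < m)%N -> 0 <= star_iter (nseq c 1%N) h m.
  by move=> m0; apply: star_iter_ge0 => // i /andP[/hh /andP[]].
have it1 c : star_iter (nseq c 1%N) h 1 = 0.
  by elim: c => [|c IH] /=; rewrite ?h1// star_sumS star_sum0 IH mul0r addr0.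
have : star_iter (ones_prefix b) h n <= tele_sum (star_iter (nseq b 1%N) h) n.
  exact: (star_sum2_le_tele (it1 b) (it0 b) n0).
move=> /le_trans; apply.
apply: (@le_trans _ _ (tele_sum ge2 n)); last exact: tele_sum_ge2.
elim: b => [|b IH] /=; first by apply: le_tele_sum => m /hh /andP[].
rewrite (le_trans _ IH)// -[leRHS]tele_sum_star_sum1// lerDl divr_ge0//.
by apply: star_sum_ge0 => m /andP[m0 _]; exact: it0.
Qed.

(** Lengthening the index by a 1 adds a sum of the form treated in
    [ones_prefix_le1], because S_1 1 - 1 is S_1 of the indicator of [2, +oo). *)
Lemma ones_prefix_bounded b n : (0 < n)%N ->
  star_iter (ones_prefix b) one n <= b.+2%:R.
Proof.
move=> n0; elim: b => [|b IH].
  apply: (@le_trans _ _ (1 + star_sum 2 ge2 n)).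
    rewrite /= /star_sum big_ltn// expr1n divr1 lerD2l.
    rewrite [leRHS]big_ltn//= mul0r add0r !big_nat; apply: ler_sum => m /andP[m1 _].
    by rewrite m1.
  rewrite -[2%:R]/(1 + 1) lerD2l; apply: (@ones_prefix_le1 0) => // m m0.
  by rewrite lexx ler0n.
have E m : (0 < m)%N -> star_sum 1 one m = star_sum 1 ge2 m + 1.
  move=> m0; rewrite /star_sum big_ltn// [in RHS]big_ltn//= mul0r add0r addrC expr1 divr1.
  by congr (_ + _); rewrite !big_nat; apply: eq_bigr => i /andP[->].
rewrite ones_prefix_rcons -cats1 star_iter_cat.
have -> : star_iter (ones_prefix b) (star_iter [:: 1%N] one) n =
    star_iter (ones_prefix b) (fun m => 1 * star_sum 1 ge2 m + 1 * 1) n.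
  by apply: eq_star_iter => // m /andP[m0 _]; rewrite /= E// !mul1r.
rewrite star_iter_lin !mul1r -[b.+3%:R]natr1 addrC lerD//.
have -> : star_iter (ones_prefix b) (star_sum 1 ge2) n = star_iter (ones_prefix b.+1) ge2 n.
  by rewrite ones_prefix_rcons -cats1 star_iter_cat.
by apply: ones_prefix_le1 => // m m0; rewrite lexx ler0n.
Qed.

Lemma harmonic_unbounded (B : R) : exists2 n, (0 < n)%N & B < star_sum 1 one n.
Proof.
apply: contrapT => H; apply: (@dvg_harmonic R).
have bnd n : series (@harmonic R) n <= Num.max B 0.
  have -> : series (@harmonic R) n = star_sum 1 one n.
    rewrite /series /star_sum big_add1 /=; apply: eq_bigr => i _.
    by rewrite /harmonic expr1 mul1r.
  case: n => [|n]; first by rewrite star_sum0 le_max lexx orbT.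
  by rewrite le_max leNgt; apply/orP; left; apply/negP => h; apply: H; exists n.+1.
have nd : nondecreasing_seq (series (@harmonic R)).
  by apply: nondecreasing_series => i _ _; exact: harmonic_ge0.
by have [l hl _] := nondecreasing_bounded_cvgn nd bnd; apply/cvg_ex; exists l.
Qed.

(** As b grows, S_1^b 1 (n) tends to n and the sum to the harmonic sum
    S_2 id (n). *)
Lemma ones_prefix_unbounded (B : R) :
  exists b n, (0 < n)%N /\ B < star_iter (ones_prefix b) one n.
Proof.
have [n n0 Bn] := harmonic_unbounded B.
apply: contrapT => H; move: Bn; rewrite ltNge => /negP; apply.
have E : star_fun (nth 1%N [:: 2%N]) n = star_sum 1 one n.
  by rewrite (@star_fun_nth1 R [:: 2%N])//= star_sum_succ_id.
have k0 i : (0 < nth 1%N [:: 2%N] i)%N by case: i => [|[]].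
have hc : (fun r => star_iter (mkseq (nth 1%N [:: 2%N]) r) one n) @ \oo
    --> star_fun (nth 1%N [:: 2%N]) n.
  by apply: star_fun_cvg => // m m0; rewrite lexx ler1n.
rewrite -E; apply: (cvgn_to_le (r0 := 1) hc) => r /subnKC <-.
rewrite (@mkseq_nth_cat 1%N [:: 2%N]) leNgt; apply/negP => h; apply: H.
by exists (r - 1)%N, n.
Qed.

(** The adjoint of S_1 increases the weights m^(-2), because the tail sum of
    i^(-2) over i >= m is at least 1/m.  On truncated sums this holds up to an
    error that vanishes when the sums with the additional 1 are truncated
    further and further out. *)
Lemma star_iter_insert1 l h (e : R) N :
  (forall m, (0 < m)%N -> 0 <= h m) -> (0 < N)%N ->
  (forall n, (0 < n)%N -> star_iter (2%N :: 1%N :: l) h n <= e) ->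
  star_iter (2%N :: l) h N <= e.
Proof.
move=> h0 N0 he; set f := star_iter l h.
have f0 m : (0 < m)%N -> 0 <= f m.
  by move=> m0; apply: star_iter_ge0 => // i /andP[i0 _]; exact: h0.
pose s := star_sum 1 f; have s0 m : 0 <= s m by apply: star_sum_ge0 => i /andP[i0 _]; exact: f0.
have h1 : star_sum 2 f N <= star_sum 2 s N + s N / (N%:R + 1).
  elim: N {N0} => [|N IH]; first by rewrite !star_sum0 add0r divr_ge0.
  have -> : s N.+1 = s N + f N.+1 / N.+1%:R by rewrite /s star_sumS expr1.
  rewrite !star_sumS; have -> : s N.+1 = s N + f N.+1 / N.+1%:R by rewrite /s star_sumS expr1.
  move: IH; have := f0 N.+1 isT; have := s0 N; rewrite natr1.
  move: (star_sum 2 f N) (star_sum 2 s N) (s N) (f N.+1) => A B C D C0 D0 IH.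
  set k : R := N.+1%:R; have k1 : 1 <= k by rewrite ler1n.
  have -> : B + (C + D / k) / k ^+ 2 + (C + D / k) / (k + 1) =
    B + C / k + D / k ^+ 2 + (C + D / k) / (k ^+ 2 * (k + 1)).
    by field; apply/andP; split; lra.
  apply: (@le_trans _ _ (B + C / k + D / k ^+ 2)); first by rewrite lerD2r.
  rewrite lerDl divr_ge0 ?addr_ge0 ?mulr_ge0 ?exprn_ge0 ?invr_ge0//; lra.
have h2 M : (N <= M)%N -> star_sum 2 f N <= star_sum 2 s M + s N / (M%:R + 1).
  move=> /subnKC <-; elim: (M - N)%N => [|d IH]; first by rewrite addn0.
  rewrite addnS star_sumS; apply: (le_trans IH); rewrite -addrA lerD2l natr1.
  have le : s N <= s (N + d).+1.
    apply: (@star_iter_nondecr _ 1 l h) => //.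
    by rewrite -addnS leq_addr.
  set k : R := (N + d).+1%:R; have k1 : 1 <= k by rewrite ler1n.
  apply: (@le_trans _ _ (s N / k ^+ 2 + s N / (k + 1))); last first.
    by rewrite lerD2r ler_wpM2r// invr_ge0 exprn_ge0//; lra.
  have -> : s N / k ^+ 2 + s N / (k + 1) = s N / k + s N / (k ^+ 2 * (k + 1)).
    by field; apply/andP; split; lra.
  by rewrite lerDl divr_ge0// mulr_ge0 ?exprn_ge0//; lra.
rewrite -/(star_sum 2 f N) in he *; apply/ler_addgt0Pr => eps eps0.
pose M := maxn N (Num.trunc (s N / eps)).+1.
have NM : (N <= M)%N by rewrite leq_maxl.
have M0 : (0 < M)%N by exact: leq_trans NM.
apply: (le_trans (h2 M NM)); apply: lerD; first exact: he.
rewrite ler_pdivrMr; last by rewrite ltr_wpDl.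
rewrite mulrC -ler_pdivrMr//.
have : s N / eps < (Num.trunc (s N / eps)).+1%:R by rewrite truncnS_gt.
have : (Num.trunc (s N / eps)).+1%:R <= M%:R :> R by rewrite ler_nat leq_maxr.
lra.
Qed.

Lemma star_iter_exp_mono l l' h n : (forall m, (0 < m)%N -> 0 <= h m) -> (0 < n)%N ->
  all2 leq l l' -> star_iter l' h n <= star_iter l h n.
Proof.
move=> h0; elim: l l' n => [|j l IH] [|j' l'] n //= n0 /andP[jj' ll'].
apply: (@le_trans _ _ (star_sum j (star_iter l' h) n)).
  apply: star_sum_exp => // m /andP[m0 _].
  by apply: star_iter_ge0 => // i /andP[i0 _]; exact: h0.
by apply: le_star_sum => m /andP[m0 _]; exact: IH.
Qed.

Lemma all2_leq_nseq1 l : all (ltn 0) l -> all2 leq (nseq (size l) 1%N) l.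
Proof. by elim: l => //= j l IH /andP[-> /IH]. Qed.

(** The cylinder of a long enough prefix is bounded: the exponents of the prefix
    dominate those of (3) or of (2, 1, ..., 1, 2), and by [star_sum_succ_id]
    the upper ends of these two cylinders are the values at (2) and
    at (2, 1, ..., 1, 1). *)
Lemma calT_bounded k : calT k ->
  exists r (e : R), forall n, (0 < n)%N -> star_iter (mkseq k r) idn n <= e.
Proof.
move=> [k0 k1 k2].
have id0 m : (0 < m)%N -> 0 <= m%:R :> R by rewrite ler0n.
move: k1; rewrite leq_eqVlt => /orP[/eqP|] E.
  have [[//|s] _ ks] := k2 (esym E).
  exists s.+2, s.+3%:R => n n0; apply: le_trans (ones_prefix_bounded s.+1 n0).
  have -> : mkseq k s.+2 = (2%N :: mkseq (fun i => k i.+1) s) ++ [:: k s.+1].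
    by rewrite (mkseq_add k 1 s.+1) (mkseqS _ s) -cats1 catA /= -E.
  rewrite star_iter_cat.
  apply: (@le_trans _ _ (star_iter (2%N :: mkseq (fun i => k i.+1) s) (star_iter [:: 1%N] one) n)).
    apply: le_star_iter => // m _ /=; rewrite -star_sum_succ_id.
    exact: star_sum_exp.
  rewrite ones_prefix_rcons -cats1 star_iter_cat.
  apply: star_iter_exp_mono => //; first by move=> m _; exact: star_sum_ge0.
  rewrite /ones_prefix -[s in nseq s _](size_mkseq (fun i => k i.+1)).
  by rewrite /= all2_leq_nseq1// all_mkseq_pos.
exists 1%N, 2%:R => n n0; apply: le_trans (ones_prefix_bounded 0 n0).
rewrite /= -star_sum_succ_id; exact: star_sum_exp.
Qed.
End UnboundedCylinders.

(** * Gaps of the value set *)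

Section EtaSet.
Context {R : realType} (q : nat).
Context (hq : (2 <= q)%N).
Implicit Types (g h : nat -> R) (b j n m N : nat) (s l : seq nat) (k : nat -> nat).
Local Notation one := (fun=> 1 : R).
Local Notation idn := (fun m : nat => m%:R : R).
Local Notation P := (@eprod R q).
Local Notation etaD := (@eta_star R @` calD q).

Lemma calT_star_fun_bounded k : calT k ->
  exists e : R, forall n, (0 < n)%N -> star_fun k n <= e.
Proof.
move=> kT; have [r [e he]] := @calT_bounded R k kT; have [k0 _ _] := kT.
by exists e => n n0; apply: le_trans (he n n0); exact: star_fun_le_iter.
Qed.

Lemma calT_eta_cvg k : calT k -> (fun n => star_fun k n.+1) @ \oo --> eta_star R k.
Proof.
move=> kT; have [e he] := calT_star_fun_bounded kT.
by have [k0 _ _] := kT; exact: eta_star_cvg he.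
Qed.

Lemma calT_eta_ge k n : calT k -> (0 < n)%N -> star_fun k n <= eta_star R k.
Proof.
move=> kT n0; have [e he] := calT_star_fun_bounded kT.
by have [k0 _ _] := kT; exact: eta_star_ge he n0.
Qed.

Lemma calT_eta_le k e : calT k -> (forall n, (0 < n)%N -> star_fun k n <= e) ->
  eta_star R k <= e.
Proof. by move=> [k0 _ _]; exact: eta_star_le. Qed.

(** The pair (s, j) indexes the gap between the cylinders of s followed by j + 1
    and of s followed by j.  With j as default value of [head], the last clause
    concerns j itself when s is empty: no cylinder starts with 1. *)
Definition gap_index s j : Prop :=
  [/\ all (fun i => 0 < i <= q)%N s, (0 < j < q)%N & (2 <= head j s)%N].

(** The index (s, j + 1, 1, 1, ...) rather than the finite index (s, j): the
    sums are the same, and this way the end is visibly a value of eta. *)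
Definition gap_left s j : R := eta_star R (nth 1%N (rcons s j.+1)).
Definition gap_right s j : R := eta_star R (nth q (rcons s j)).

Lemma nth_between d s i : (0 < d <= q)%N -> all (fun i => 0 < i <= q)%N s ->
  (0 < nth d s i <= q)%N.
Proof.
move=> hd hs; have [il|il] := ltnP i (size s); first exact: (all_nthP _ hs).
by rewrite nth_default.
Qed.

Lemma calD_nthq s : all (fun i => 0 < i <= q)%N s -> (2 <= head q s)%N ->
  calD q (nth q s).
Proof.
have q0 : (0 < q <= q)%N by rewrite leqnn andbT ltnW.
move=> hs hd; split; last by move=> i; case/andP: (nth_between i q0 hs).
split; first by move=> i; case/andP: (nth_between i q0 hs).
  by rewrite nth0.
by move=> _; exists (size s).+1 => //; rewrite nth_default.
Qed.

Lemma calD_gap_left s j : gap_index s j -> calD q (nth 1%N (rcons s j.+1)).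
Proof.
move=> [hs /andP[j0 jq] hd].
have q0 : (0 < 1 <= q)%N by exact: ltnW.
have hs' : all (fun i => 0 < i <= q)%N (rcons s j.+1) by rewrite all_rcons jq.
split; last by move=> i; case/andP: (nth_between i q0 hs').
split; first by move=> i; case/andP: (nth_between i q0 hs').
  by case: s hd {hs hs'} => //= hd; exact: leqW.
case: s hd {hs hs'} => [/= hd [j1]|i s /= _ _]; first by rewrite j1 in hd.
by exists (size s).+1 => //=; rewrite nth_rcons ltnn eqxx.
Qed.

Lemma all_posW s : all (fun i => 0 < i <= q)%N s -> all (ltn 0) s.
Proof. by apply: sub_all => i /andP[]. Qed.

Lemma gap_index_rcons s j : gap_index s j -> all (fun i => 0 < i <= q)%N (rcons s j).
Proof. by move=> [hs /andP[j0 jq] _]; rewrite all_rcons j0 (ltnW jq). Qed.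

Lemma gap_index_pos s j : gap_index s j -> all (ltn 0) (rcons s j).
Proof. by move=> /gap_index_rcons; exact: all_posW. Qed.

Lemma calD_gap_right s j : gap_index s j -> calD q (nth q (rcons s j)).
Proof.
move=> h; apply: calD_nthq; first exact: gap_index_rcons.
by case: h; case: s.
Qed.

Lemma calD_gap_below s j : gap_index s j -> calD q (nth q s).
Proof. by move=> [hs _ hd]; apply: calD_nthq => //; case: s hd {hs}. Qed.

Lemma star_fun_gap_left s j n : gap_index s j -> (0 < n)%N ->
  star_fun (nth 1%N (rcons s j.+1)) n = star_iter (rcons s j) one n.
Proof.
move=> [hs _ _] n0; rewrite star_fun_nth1//; last by rewrite all_rcons /= all_posW.
rewrite -!cats1 !star_iter_cat; apply: eq_star_iter => // m _ /=.
exact: star_sum_succ_id.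
Qed.

Lemma star_fun_gap_right s j n : gap_index s j -> (0 < n)%N ->
  star_fun (nth q (rcons s j)) n = star_iter (rcons s j) P n.
Proof. by move=> h n0; rewrite star_fun_nthq//; exact: gap_index_pos h. Qed.

Lemma gap_left_cvg s j : gap_index s j ->
  (fun n => star_iter (rcons s j) one n.+1) @ \oo --> gap_left s j.
Proof.
move=> h; have [hT _] := calD_gap_left h.
have <- : (fun n => star_fun (nth 1%N (rcons s j.+1)) n.+1) =
    fun n => star_iter (rcons s j) one n.+1.
  by apply/funext => n; rewrite star_fun_gap_left.
exact: calT_eta_cvg.
Qed.

Lemma gap_right_cvg s j : gap_index s j ->
  (fun n => star_iter (rcons s j) P n.+1) @ \oo --> gap_right s j.
Proof.
move=> h; have [hT _] := calD_gap_right h.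
have <- : (fun n => star_fun (nth q (rcons s j)) n.+1) = fun n => star_iter (rcons s j) P n.+1.
  by apply/funext => n; rewrite star_fun_gap_right.
exact: calT_eta_cvg.
Qed.

Lemma gap_left_ge s j n : gap_index s j -> (0 < n)%N ->
  star_iter (rcons s j) one n <= gap_left s j.
Proof.
by move=> h n0; have [hT _] := calD_gap_left h; rewrite -star_fun_gap_left// calT_eta_ge.
Qed.

Lemma gap_right_ge s j n : gap_index s j -> (0 < n)%N ->
  star_iter (rcons s j) P n <= gap_right s j.
Proof.
by move=> h n0; have [hT _] := calD_gap_right h; rewrite -star_fun_gap_right// calT_eta_ge.
Qed.

Lemma gap_left_le s j e : gap_index s j ->
  (forall n, (0 < n)%N -> star_iter (rcons s j) one n <= e) -> gap_left s j <= e.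
Proof.
move=> h he; have [hT _] := calD_gap_left h; apply: calT_eta_le => // n n0.
by rewrite star_fun_gap_left// he.
Qed.

Lemma gap_right_le s j e : gap_index s j ->
  (forall n, (0 < n)%N -> star_iter (rcons s j) P n <= e) -> gap_right s j <= e.
Proof.
move=> h he; have [hT _] := calD_gap_right h; apply: calT_eta_le => // n n0.
by rewrite star_fun_gap_right// he.
Qed.

Lemma star_fun_eprod n : (0 < n)%N -> star_fun (fun=> q) n = P n.
Proof.
move=> n0; rewrite -[RHS](@star_fun_nthq R q [::] n)//.
by congr star_fun; apply/funext => i; rewrite nth_nil.
Qed.

Lemma calD_const : calD q (fun=> q).
Proof. by split=> //; split => // [_|_]; [exact: ltnW|exists 1%N]. Qed.

Lemma eta_min k : calD q k -> eta_star R (fun=> q) <= eta_star R k.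
Proof.
move=> [kT kq]; have [cT _] := calD_const; apply: calT_eta_le => // n n0.
have [k0 _ _] := kT; rewrite star_fun_eprod//.
apply: le_trans (calT_eta_ge kT n0).
by apply: (@star_fun_ge_iter_eprod R q k 0 n) => // i; rewrite k0 kq.
Qed.

Lemma eta_ge1 k : calD q k -> 1 <= eta_star R k.
Proof.
move=> [kT kq]; have [k0 _ _] := kT.
exact: le_trans (star_fun_ge1 k0 (isT : (0 < 1)%N)) (calT_eta_ge kT _).
Qed.

(** If k starts with (s, j) then its value is at least that of (s, j, q, q, ...);
    otherwise [star_iter_cmp] puts it on one side of the whole gap. *)
Lemma eta_outside_gap s j k : gap_index s j -> calD q k ->
  eta_star R k <= gap_left s j \/ gap_right s j <= eta_star R k.
Proof.
move=> h [kT kq]; have [k0 _ _] := kT.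
set r := (size s).+1; have szr : size (mkseq k r) = size (rcons s j).
  by rewrite size_mkseq size_rcons.
have eqP_le : rcons s j = mkseq k r -> gap_right s j <= eta_star R k.
  move=> E; apply: gap_right_le => // n n0; rewrite E.
  apply: le_trans (calT_eta_ge kT n0).
  by apply: star_fun_ge_iter_eprod => // i; rewrite k0 kq.
have [/prefixP[t E]|/prefixP[t E]|H|H] :=
  @star_iter_cmp R _ _ (gap_index_pos h) (all_mkseq_pos r k0).
- right; apply: eqP_le; rewrite E; case: t E => [|a t]; first by rewrite cats0.
  by move=> /(congr1 size) /eqP; rewrite szr size_cat -[X in X == _]addn0 eqn_add2l.
- right; apply: eqP_le; rewrite E; case: t E => [|a t]; first by rewrite cats0.
  by move=> /(congr1 size) /eqP; rewrite -szr size_cat -[X in X == _]addn0 eqn_add2l.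
- right; apply: gap_right_le => // n n0; apply: le_trans (calT_eta_ge kT n0).
  apply: le_trans (star_iter_le_fun k0 r n0); apply: le_trans (H n n0).
  by apply: le_star_iter => // m /andP[m0 _]; exact: eprod_le_id.
- left; apply: calT_eta_le => // n n0; apply: le_trans (gap_left_ge h n0).
  exact: le_trans (star_fun_le_iter k0 r n0) (H n n0).
Qed.

(** Greedy expansion.  Having found a prefix l with L_l P <= z <= L_l id, append
    the least j for which L_(l,j) P <= z still holds: as j - 1 fails and z is not
    in the gap of index j - 1, one has z <= L_(l,j-1) 1 = L_(l,j) id.  The lower
    condition is formulated on truncations and the upper one through upper
    bounds because both limits may be infinite while the prefix
    is (2, 1, ..., 1). *)
Lemma eta_hits z : eta_star R (fun=> q) <= z ->
  (forall s j, gap_index s j -> z <= gap_left s j \/ gap_right s j <= z) ->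
  etaD z.
Proof.
move=> mz ngap.
pose low l := forall n, (0 < n)%N -> star_iter l P n <= z.
pose inv l := [/\ all (fun i => 0 < i <= q)%N l, low l &
  forall B, (forall n, (0 < n)%N -> star_iter l idn n <= B) -> z <= B].
have one_le l g n : (0 < n)%N -> (forall m, (0 < m)%N -> 1 <= g m) ->
    star_sum 1 one n <= star_iter (1%N :: l) g n.
  move=> n0 g1; apply: le_star_sum => m /andP[m0 _].
  by apply: star_iter_ge1 => // i /andP[i0 _]; exact: g1.
have head1 t g B : (forall m, (0 < m)%N -> 1 <= g m) ->
    (forall n, (0 < n)%N -> star_iter (1%N :: t) g n <= B) -> False.
  move=> g1 hB; have [n n0] := harmonic_unbounded B; rewrite ltNge => /negP; apply.
  exact: le_trans (one_le t g n n0 g1) (hB n n0).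
have P1 m : (0 < m)%N -> 1 <= P m by move=> _; exact: eprod_ge1.
have inv0 : inv [::].
  split => // [n n0 /=|B hB].
    apply: le_trans mz; rewrite -star_fun_eprod//; apply: calT_eta_ge => //.
    by case: calD_const.
  have := hB (Num.trunc z).+1 isT; apply: le_trans; apply/ltW; exact: truncnS_gt.
have step l : exists j, inv l -> inv (rcons l j).
  have [il|nil] := pselect (inv l); last by exists 0%N.
  have [al ll ul] := il.
  have exq : exists j, (0 < j)%N && `[< low (rcons l j) >].
    exists q; rewrite (ltnW hq); apply/asboolP => n n0.
    rewrite -cats1 star_iter_cat (@eq_star_iter _ _ _ P)//; first exact: ll.
    by move=> m /andP[m0 _]; exact: star_sum_eprod.
  case: (ex_minnP exq) => j /andP[j0 /asboolP lj] jmin.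
  have jq : (j <= q)%N.
    apply: jmin; rewrite (ltnW hq); apply/asboolP => n n0.
    rewrite -cats1 star_iter_cat (@eq_star_iter _ _ _ P)//; first exact: ll.
    by move=> m /andP[m0 _]; exact: star_sum_eprod.
  exists j => _; split => //; first by rewrite all_rcons j0 jq.
  move=> B hB; case: j j0 lj jmin jq hB => [//|[|i]] _ lj jmin jq hB.
    apply: ul => n n0; apply: le_trans (hB n n0); rewrite -cats1 star_iter_cat.
    by apply: le_star_iter => // m _ /=; rewrite star_sum1_id.
  have hB' n : (0 < n)%N -> star_iter (rcons l i.+1) one n <= B.
    move=> n0; apply: le_trans (hB n n0); rewrite -!cats1 !star_iter_cat.
    by apply: le_star_iter => // m _ /=; rewrite star_sum_succ_id.
  have nlow : ~ low (rcons l i.+1).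
    move=> li; have /jmin : (0 < i.+1)%N && `[< low (rcons l i.+1) >] by apply/asboolP.
    by rewrite ltnn.
  have [hd|hd] := leqP 2 (head i.+1 l).
    have gi : gap_index l i.+1 by split.
    have [zx|yz] := ngap _ _ gi; first exact: le_trans zx (gap_left_le gi hB').
    by case: nlow => n n0; exact: le_trans (gap_right_ge gi n0) yz.
  exfalso; have [t E] : exists t, rcons l i.+1 = 1%N :: t.
    case: l hd {il ul ll exq jmin nlow hB hB' lj} al => [|a l] /=.
      by case: i {jq} => // _ _; exists [::].
    by case: a => [|[|a]] //= _ _; exists (rcons l i.+1).
  by apply: (head1 t one B) => // n n0; rewrite -E; exact: hB'.
have [f hf] := choice step.
pose lst := fix lst r := if r is r'.+1 then rcons (lst r') (f (lst r')) else [::].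
pose k r := f (lst r).
have klst r : mkseq k r = lst r by elim: r => //= r IH; rewrite mkseqS IH.
have ik r : inv (mkseq k r) by rewrite klst; elim: r => //= r IH; exact: hf.
have kb i : (0 < k i <= q)%N.
  by have [+ _ _] := ik i.+1; rewrite mkseqS all_rcons => /andP[].
have k0 i : (0 < k i)%N by case/andP: (kb i).
have kT : calT k.
  split => //.
    rewrite ltn_neqAle k0 andbT eq_sym; apply/eqP => k1.
    by have [_ l1 _] := ik 1%N; apply: (head1 [::] P z) => // n /l1; rewrite /= k1.
  move=> k2; apply: contrapT => H.
  have ks i : (0 < i)%N -> k i = 1%N.
    move=> i0; apply/eqP; rewrite eqn_leq k0 andbT leqNgt; apply/negP => ki.
    by apply: H; exists i.
  have [b [n [n0]]] := ones_prefix_unbounded z; rewrite ltNge => /negP; apply.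
  have E : mkseq k b.+1 = ones_prefix b.
    rewrite (mkseq_add k 1 b) /ones_prefix /= k2; congr (_ :: _).
    apply: (@eq_from_nth _ 0%N); rewrite ?size_mkseq ?size_nseq// => i ib.
    by rewrite nth_mkseq// nth_nseq ib ks.
  have [_ lb _] := ik b.+1; apply: le_trans (lb n n0); rewrite E.
  by apply: le_star_iter => // m /andP[m0 _]; exact: P1.
exists k; first by split => // i; case/andP: (kb i).
apply/eqP; rewrite eq_le; apply/andP; split.
  apply: calT_eta_le => // n n0.
  have hc : (fun r => star_iter (mkseq k r) P n) @ \oo --> star_fun k n.
    by apply: star_fun_cvg => // m m0; rewrite eprod_ge1// eprod_le_id.
  by apply: (cvgn_to_le (r0 := 0) hc) => r _; have [_ + _] := ik r; apply.
apply/ler_addgt0Pr => eps eps0.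
have [r0 [e he]] := @calT_bounded R k kT.
pose T n := star_iter (mkseq k r0.+1) idn n.+1.
have idn0 m : (0 < m)%N -> 0 <= m%:R :> R by rewrite ler0n.
have T_nd : nondecreasing_seq T.
  by move=> m n mn; apply: star_iter_nondecr.
have sub r : (r0 < r)%N -> forall n, (0 < n)%N ->
    star_iter (mkseq (fun i => k i.+1) r.-1) idn n <= star_iter (mkseq (fun i => k i.+1) r0) idn n.
  case: r => // r; rewrite ltnS => /subnKC <- n n0 /=.
  rewrite mkseq_add star_iter_cat; apply: le_star_iter => // m /andP[m0 _].
  apply: star_iter_le_id => //; first by apply: all_mkseq_pos => i; exact: k0.
  by move=> i _; rewrite ler0n lexx.
have T_le n : T n <= e.
  apply: le_trans (he n.+1 isT); rewrite /T -addn1 mkseq_add star_iter_cat.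
  apply: le_star_iter => // m /andP[m0 _]; apply: star_iter_le_id => //.
    by apply: all_mkseq_pos => i; exact: k0.
  by move=> i _; rewrite ler0n lexx.
have [L hL [TL _]] := nondecreasing_bounded_cvgn T_nd T_le.
have [N _ /(_ N (leqnn N)) hN] : \forall n \near \oo, `|L - T n| < eps / 2.
  by move/cvgrPdist_lt: hL; apply; rewrite divr_gt0.
have cN : (fun r => star_iter (mkseq k r) idn N.+1) @ \oo --> star_fun k N.+1.
  by apply: star_fun_cvg => // m m0; rewrite lexx ler1n m0.
have [r1 _ hr] : \forall r \near \oo, `|star_fun k N.+1 - star_iter (mkseq k r) idn N.+1| < eps / 2.
  by move/cvgrPdist_lt: cN; apply; rewrite divr_gt0.
pose r := (maxn r0 r1).+1.
(* beyond N, passing from r to the shorter prefix r0 + 1 only increases the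
   increments, and those are controlled by the convergence of T *)
have [_ _ +] := ik r; apply => n n0.
have hrN := hr r (leqW (leq_maxr r0 r1)).
have etaN := calT_eta_ge kT (isT : (0 < N.+1)%N).
move: hN hrN; rewrite !ltr_norml => /andP[_ hN] /andP[hrN _].
have mkE r' : mkseq k r'.+1 = k 0%N :: mkseq (fun i => k i.+1) r'.
  by rewrite (mkseq_add k 1 r').
have [nN|Nn] := leqP n N.+1.
  suff : star_iter (mkseq k r) idn n <= star_iter (mkseq k r) idn N.+1 by lra.
  by rewrite mkE; apply: star_iter_nondecr.
case: n n0 Nn => // n _; rewrite ltnS => Nn.
suff : star_iter (mkseq k r) idn n.+1 - star_iter (mkseq k r) idn N.+1 <= T n - T N.
  by have := TL n; lra.
have dif M : T M - star_iter (mkseq k r) idn M.+1 = star_iter [:: k 0%N]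
   (fun m => star_iter (mkseq (fun i => k i.+1) r0) idn m
             - star_iter (mkseq (fun i => k i.+1) r.-1) idn m) M.+1.
  by rewrite star_iterB /T !mkE.
suff : T N - star_iter (mkseq k r) idn N.+1 <= T n - star_iter (mkseq k r) idn n.+1 by lra.
rewrite !dif; apply: star_iter_nondecr => [m m0|]; last exact: ltnW.
by rewrite subr_ge0; apply: sub => //; rewrite ltnS leq_maxl.
Qed.
End EtaSet.

(** * Thickness of the value set and of its logarithm *)

Section Thickness.
Context {R : realType} (q : nat).
Context (hq : (2 <= q)%N).
Implicit Types (g h : nat -> R) (j n m N : nat) (s l : seq nat) (k : nat -> nat).
Local Notation one := (fun=> 1 : R).
Local Notation idn := (fun m : nat => m%:R : R).
Local Notation P := (@eprod R q).
Local Notation etaD := (@eta_star R @` calD q).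
Local Notation gap_left := (@gap_left R).
Local Notation gap_right := (@gap_right R q).

(** The complement is the union of a half-line and of the open gaps. *)
Lemma etaD_closed : closed etaD.
Proof.
suff H (z : R) : closure etaD z -> etaD z by exact: H.
move=> clz; have near (e : R) : 0 < e -> exists2 a, etaD a & `|z - a| < e.
  by move=> e0; have [a [Aa za]] := clz _ (nbhsx_ballx z e e0); exists a.
apply: (eta_hits hq).
  rewrite leNgt; apply/negP => zm; have [|_ [k kD <-]] := near (eta_star R (fun=> q) - z).
    by rewrite subr_gt0.
  by have := @eta_min R q hq k kD; rewrite ltr_norml; lra.
move=> s j h; have [zx|xz] := leP z (gap_left s j); first by left.
have [yz|zy] := leP (gap_right s j) z; first by right.
have [|_ [k kD <-]] := near (Num.min (z - gap_left s j) (gap_right s j - z)).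
  by rewrite lt_min !subr_gt0 xz.
rewrite lt_min !ltr_norml => /andP[/andP[_ h1] /andP[h2 _]].
have [] := @eta_outside_gap R q hq s j k h kD => h3; exfalso; lra.
Qed.

Lemma etaD_gap_left s j : gap_index q s j -> etaD (gap_left s j).
Proof. by move=> h; exists (nth 1%N (rcons s j.+1)) => //; exact: calD_gap_left. Qed.

Lemma etaD_gap_right s j : gap_index q s j -> etaD (gap_right s j).
Proof. by move=> h; exists (nth q (rcons s j)) => //; exact: calD_gap_right. Qed.

Lemma etaD_gap_below s j : gap_index q s j -> etaD (eta_star R (nth q s)).
Proof. by move=> h; exists (nth q s) => //; exact: calD_gap_below h. Qed.

Lemma etaD_gapP a b : gap etaD a b ->
  exists s j, [/\ gap_index q s j, a = gap_left s j & b = gap_right s j].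
Proof.
move=> [Aa Ab ab nA]; have [k kD ka] := Aa; have ma := @eta_min R q hq k kD; rewrite ka in ma.
pose z := (a + b) / 2.
have [s [j [h h1]]] : exists s j, gap_index q s j /\ gap_left s j < z < gap_right s j.
  apply: contrapT => H; have : etaD z.
    apply: (eta_hits hq); first by rewrite /z; lra.
    move=> s j h; have [zx|xz] := leP z (gap_left s j); first by left.
    have [yz|zy] := leP (gap_right s j) z; first by right.
    by case: H; exists s, j; rewrite xz zy.
  by move=> /nA; rewrite /z; lra.
exists s, j; split => //.
- have Ax : etaD (gap_left s j) by exact: etaD_gap_left.
  have [k' k'D k'a] := Aa.
  have := nA _ Ax; have := @eta_outside_gap R q hq s j k' h k'D; rewrite k'a.
  move: h1; rewrite /z => /andP[? ?] [?|?] [?|?]; lra.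
- have Ay : etaD (gap_right s j) by exact: etaD_gap_right.
  have [k' k'D k'b] := Ab.
  have := nA _ Ay; have := @eta_outside_gap R q hq s j k' h k'D; rewrite k'b.
  move: h1; rewrite /z => /andP[? ?] [?|?] [?|?]; lra.
Qed.

Lemma gap_length_cvg s j : gap_index q s j ->
  (fun n => star_iter (rcons s j) (fun m => P m - 1) n.+1) @ \oo
    --> gap_right s j - gap_left s j.
Proof.
move=> h; under eq_fun do rewrite star_iterB.
by apply: cvgB; [exact: (gap_right_cvg hq h)|exact: (gap_left_cvg hq h)].
Qed.

Lemma eprodB1_ge0 m : 0 <= P m - 1.
Proof. by rewrite subr_ge0 eprod_ge1. Qed.

Lemma gap_length_ge s j n : gap_index q s j -> (0 < n)%N ->
  star_iter (rcons s j) (fun m => P m - 1) n <= gap_right s j - gap_left s j.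
Proof.
move=> h; case: n => // n _; apply: (cvgn_to_ge (r0 := n) (gap_length_cvg h)) => r nr.
case: s h => [|i s] _; apply: star_iter_nondecr => // m _; exact: eprodB1_ge0.
Qed.

Lemma gap_length_le s j e : gap_index q s j ->
  (forall n, (0 < n)%N -> star_iter (rcons s j) (fun m => P m - 1) n <= e) ->
  gap_right s j - gap_left s j <= e.
Proof.
by move=> h he; apply: (cvgn_to_le (r0 := 0) (gap_length_cvg h)) => r _; exact: he.
Qed.

Lemma star_iter_gt0 l h : 0 <= h 1%N -> 0 < h 2%N ->
  0 <= star_iter l h 1 /\ 0 < star_iter l h 2.
Proof.
move=> h1 h2; elim: l => [//|j l [IH1 IH2]] /=.
rewrite !star_sumS star_sum0 add0r; split; first by rewrite expr1n divr1.
by rewrite ltr_wpDl ?divr_ge0// divr_gt0// exprn_gt0.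
Qed.

Lemma gap_left_lt_right s j : gap_index q s j -> gap_left s j < gap_right s j.
Proof.
move=> h; rewrite -subr_gt0; apply: lt_le_trans (gap_length_ge h (isT : (0 < 2)%N)).
apply: (star_iter_gt0 _ _ _).2; first exact: eprodB1_ge0.
rewrite subr_gt0 (@eprodS R q 1)// eprod1 mul1r.
have h2 := @euler_factor_gt0 R q hq 2 isT.
rewrite ltr_pdivlMr// mul1r gtrBl divr_gt0// exprn_gt0//.
Qed.

(** The value at (s, q, q, ...) lies below the gap at a distance at least its
    length. *)
Lemma gap_left_below s j : gap_index q s j ->
  eta_star R (nth q s) + gap_right s j <= 2 * gap_left s j.
Proof.
move=> h; have [hs /andP[_ jq] _] := h; have [sT _] := calD_gap_below hq h.
apply: (@ler_cvgn R (fun n => star_fun (nth q s) n.+1 + star_iter (rcons s j) P n.+1)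
  (fun n => 2 * star_iter (rcons s j) one n.+1)).
- by apply: cvgD; [exact: (calT_eta_cvg sT)|exact: (gap_right_cvg hq h)].
- by apply: cvgM; [exact: cvg_cst|exact: (gap_left_cvg hq h)].
- move=> n; rewrite star_fun_nthq//; last exact: all_posW hs.
  exact: star_iter_split.
Qed.


(** If (s, j) is not a prefix of (s', j'), the whole cylinder of (s, j) lies
    between the two gaps and Cauchy-Schwarz applies.  If it is, the second gap
    lies inside that cylinder, and what lies between the gaps contains
    the piece of the cylinder of s' below the second one. *)
Lemma gaps_separated s j s' j' : gap_index q s j -> gap_index q s' j' ->
  gap_right s j <= gap_left s' j' ->
  gap_right s j ^+ 2 <= gap_left s j * gap_left s' j' \/
  ((size s < size s')%N /\ gap_right s j + gap_right s' j' <= 2 * gap_left s' j').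
Proof.
move=> h h' le; have lt := gap_left_lt_right h; have lt' := gap_left_lt_right h'.
have [/prefixP[t E]|/prefixP[t E]|H|H] :=
  @star_iter_cmp R _ _ (gap_index_pos h) (gap_index_pos h').
- right; case/lastP: t E => [|t i E].
    rewrite cats0 => E; move: le lt; rewrite /gap_left.
    by have [_ <-] := rcons_inj E; have [<- _] := rcons_inj E; lra.
  move: E; rewrite -rcons_cat => /rcons_inj[E Ei].
  have ht : all (leq^~ q) t.
    by have [+ _ _] := h'; rewrite E all_cat => /andP[_]; apply: sub_all => a /andP[].
  split; first by rewrite E size_cat size_rcons addSn ltnS leq_addr.
  apply: le_trans (gap_left_below h'); rewrite lerD2r.
  have [sT _] := calD_gap_below hq h'; have [hs' _ _] := h'.
  apply: gap_right_le => // n n0; apply: le_trans (calT_eta_ge sT n0).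
  rewrite star_fun_nthq//; last exact: all_posW hs'.
  rewrite E star_iter_cat; apply: le_star_iter => // m /andP[m0 _].
  exact: eprod_le_iter.
- suff : gap_left s' j' <= gap_left s j by lra.
  apply: (gap_left_le hq h') => // n n0; apply: le_trans (gap_left_ge hq h n0).
  rewrite E star_iter_cat; apply: le_star_iter => // m /andP[m0 _].
  exact: star_iter_ge1.
- left; rewrite expr2.
  apply: (@ler_cvgn R (fun n => star_iter (rcons s j) P n.+1 * star_iter (rcons s j) P n.+1)
    (fun n => star_iter (rcons s j) one n.+1 * star_iter (rcons s' j') one n.+1)).
  + by apply: cvgM; exact: (gap_right_cvg hq h).
  + by apply: cvgM; [exact: (gap_left_cvg hq h)|exact: (gap_left_cvg hq h')].
  + move=> n; rewrite -expr2.
    apply: (le_trans (star_iter_eprod_sqr hq (rcons s j) (isT : (0 < n.+1)%N))).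
    by apply: ler_wpM2l; [apply: star_iter_ge0 => // m _; exact: ler01|exact: H].
- suff : gap_right s' j' <= gap_left s j by lra.
  apply: gap_right_le => // n n0; apply: le_trans (gap_left_ge hq h n0).
  apply: le_trans (H n n0); apply: le_star_iter => // m /andP[m0 _].
  exact: eprod_le_id.
Qed.

Lemma gap_left_ge1 s j : gap_index q s j -> 1 <= gap_left s j.
Proof. by move=> /(calD_gap_left hq); exact: eta_ge1. Qed.

Lemma amgm_gap (x y x' : R) : 0 <= x -> 0 <= x' -> y ^+ 2 <= x * x' ->
  y - x <= x' - y.
Proof. by move=> x0 x'0 sq; have := sqr_ge0 (x - x'); nra. Qed.

Lemma etaD_thick : thick etaD.
Proof.
split; first exact: etaD_closed.
- move=> a b a' b' /etaD_gapP[s [j [h -> ->]]] /etaD_gapP[s' [j' [h' -> ->]]] le.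
  have := gap_left_ge1 h; have := gap_left_ge1 h'; move: le (gaps_separated h h' le).
  move: (gap_left s j) (gap_right s j) (gap_left s' j') (gap_right s' j')
    => x y x' y' le [sq|[_ lin]] x1' x1.
    by left; apply: amgm_gap sq; lra.
  by right; lra.
- move=> a b /etaD_gapP[s [j [h -> ->]]]; have := gap_left_below h.
  by exists (eta_star R (nth q s)); [exact: etaD_gap_below h|lra].
Qed.

Lemma ones_gap_index b : gap_index q (ones_prefix b) 1.
Proof.
split => //=.
by rewrite hq all_nseq /= (ltnW hq) orbT.
Qed.

Definition ones_left b := gap_left (ones_prefix b) 1.
Definition ones_right b := gap_right (ones_prefix b) 1.
Definition ones_length b := ones_right b - ones_left b.

Lemma ones_left_in b : etaD (ones_left b).
Proof. exact: etaD_gap_left (ones_gap_index b). Qed.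

Lemma ones_right_in b : etaD (ones_right b).
Proof. exact: etaD_gap_right (ones_gap_index b). Qed.

(** Inserting a 1 after the initial 2 only increases the weights. *)
Lemma ones_length_nondecr : nondecreasing_seq ones_length.
Proof.
apply/nondecreasing_seqP => b; apply: gap_length_le; first exact: ones_gap_index.
move=> n n0; rewrite -ones_prefix_rcons.
apply: star_iter_insert1 => // [m _|N N0]; first exact: eprodB1_ge0.
have := gap_length_ge (ones_gap_index b.+1) N0; rewrite -ones_prefix_rcons.
exact.
Qed.

Lemma ones_length_le1 b : ones_length b <= 1.
Proof.
apply: gap_length_le => [|n n0]; first exact: ones_gap_index.
rewrite -ones_prefix_rcons; apply: ones_prefix_le1 => // m m0.
rewrite eprodB1_ge0 /=; case: m m0 => [//|[|m]] _ /=; first by rewrite eprod1 subrr.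
by rewrite lerBlDr; exact: eprod_le2.
Qed.

(** Among the prefixes of a given length, (2, 1, ..., 1) has the largest
    weights. *)
Lemma gap_length_le_ones s j : gap_index q s j ->
  gap_right s j - gap_left s j <= ones_length (size s).
Proof.
move=> h; apply: gap_length_le => // n n0.
apply: (@le_trans _ _ (star_iter (ones_prefix (size s)) (fun m => P m - 1) n)).
  apply: star_iter_exp_mono => // [m _|]; first exact: eprodB1_ge0.
  have := gap_index_pos h; case: h => _ _.
  case: s => [|i s] /= hd; first by rewrite hd.
  by move=> /andP[_] /all2_leq_nseq1; rewrite hd size_rcons.
apply: star_iter_insert1 => // [m _|N N0]; first exact: eprodB1_ge0.
have := gap_length_ge (ones_gap_index (size s)) N0; rewrite -ones_prefix_rcons.
exact.
Qed.

Lemma ones_left_nondecr : nondecreasing_seq ones_left.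
Proof.
apply/nondecreasing_seqP => b; apply: (gap_left_le hq (ones_gap_index b)) => // n n0.
apply: le_trans (gap_left_ge hq (ones_gap_index b.+1) n0).
rewrite -!ones_prefix_rcons (ones_prefix_rcons b.+1) -cats1 star_iter_cat.
by apply: le_star_iter => // m /andP[m0 _]; exact: star_iter_ge1.
Qed.

Lemma ones_left_unbounded (B : R) : exists b, B < ones_left b.
Proof.
have [b [n [n0 h]]] := ones_prefix_unbounded B; exists b; apply: (lt_le_trans h).
apply: le_trans (gap_left_ge hq (ones_gap_index b) n0).
rewrite -cats1 star_iter_cat.
by apply: le_star_iter => // m /andP[m0 _]; exact: star_iter_ge1.
Qed.

Lemma etaD_unbounded (B : R) : exists2 a, etaD a & B <= a.
Proof.
by have [b Bb] := ones_left_unbounded B; exists (ones_left b); [exact: ones_left_in|exact: ltW].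
Qed.

Lemma etaD_const : etaD (eta_star R (fun=> q)).
Proof. by exists (fun=> q) => //; exact: calD_const. Qed.

Lemma etaD_min z : etaD z -> eta_star R (fun=> q) <= z.
Proof. by move=> [k kD <-]; exact: eta_min. Qed.

Lemma etaD_gt0 z : etaD z -> 0 < z.
Proof. by move=> [k kD <-]; apply: lt_le_trans ltr01 (eta_ge1 kD). Qed.

(** A point z common to A and t + A gives t = z - (z - t).  The descent
    starts at the left end of a remote gap of (2, 1, ..., 1): the gaps of A
    below it are separated from it by a cylinder, or are shorter than it. *)
Lemma etaD_sub_gt0 t : 0 < t -> exists a b, [/\ etaD a, etaD b & a - b = t].
Proof.
move=> t0; set m := eta_star R (fun=> q).
have [b mb] := ones_left_unbounded (m + t).
have [c Ac bc] := etaD_unbounded (ones_left b).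
have [] := @meet_from_right_end R [set z | etaD (z - t)] etaD (m + t) (ones_left b)
    (m + t) (c + t) m.
- exact: thick_shift etaD_thick.
- exact: etaD_thick.
- by move=> z /= /etaD_min; rewrite -/m; lra.
- exact: ones_left_in.
- move=> v w /etaD_gapP[s [j [h -> ->]]] le.
  have [sq|[sz lin]] := gaps_separated h (ones_gap_index b) le.
    have := gap_left_ge1 h; have := gap_left_ge1 (ones_gap_index b).
    move: sq le; rewrite -/(ones_left b).
    move: (gap_left s j) (gap_right s j) (ones_left b) => x y x' sq le x1' x1.
    by apply: amgm_gap sq; lra.
  move: sz; rewrite /= size_nseq ltnS => sz.
  have := gap_length_le_ones h; have := ones_length_nondecr sz.
  by move: lin; rewrite /ones_length -/(ones_left b) -/(ones_right b); lra.
- by rewrite /= addrK; exact: etaD_const.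
- exact: ltW.
- by rewrite /= addrK.
- lra.
- exact: etaD_const.
- lra.
by move=> z /= Azt Az; exists z, (z - t); split => //; lra.
Qed.

Let lnA : set R := [set ln a | a in etaD].

Lemma gap_ln x y : gap lnA x y ->
  exists a b, [/\ gap etaD a b, x = ln a & y = ln b].
Proof.
move=> [[a Aa xa] [b Ab yb] xy nA]; exists a, b; split => //; split => //.
  by move: xy; rewrite -xa -yb ltr_ln ?posrE ?etaD_gt0.
move=> z Az; have := nA (ln z) (ex_intro2 _ _ z Az erefl).
by rewrite -xa -yb !ler_ln ?posrE ?etaD_gt0.
Qed.

Lemma closed_lnA : closed lnA.
Proof.
have -> : lnA = expR @^-1` etaD.
  apply/seteqP; split => [_ [a Aa <-]|x /= Ax]; last by exists (expR x) => //; rewrite expRK.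
  by rewrite /= lnK// posrE etaD_gt0.
by apply: closed_comp; [move=> x _; exact: continuous_expR|exact: etaD_closed].
Qed.

Lemma lnA_thick : thick lnA.
Proof.
split; first exact: closed_lnA.
- move=> ? ? ? ? /gap_ln[a [b [+ -> ->]]] /gap_ln[a' [b' [+ -> ->]]].
  move=> g g'; have [/etaD_gt0 a0 /etaD_gt0 b0 _ _] := g.
  have [/etaD_gt0 a0' /etaD_gt0 b0' _ _] := g'.
  rewrite ler_ln ?posrE// => le.
  have [s [j [h ea eb]]] := etaD_gapP g; have [s' [j' [h' ea' eb']]] := etaD_gapP g'.
  have := gaps_separated h h'; rewrite -ea -ea' -eb -eb' => /(_ le) [sq|[_ lin]].
    left; have : ln (b * b) <= ln (a * a') by rewrite ler_ln ?posrE ?mulr_gt0// -expr2.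
    by rewrite !lnM ?posrE//; lra.
  right; have : ln (b * b') <= ln (a' * a').
    by rewrite ler_ln ?posrE ?mulr_gt0//; have := sqr_ge0 (b - b'); nra.
  by rewrite !lnM ?posrE//; lra.
- move=> ? ? /gap_ln[a [b [g -> ->]]].
  have [/etaD_gt0 a0 /etaD_gt0 b0 _ _] := g.
  have [s [j [h ea eb]]] := etaD_gapP g; have := gap_left_below h; rewrite -ea -eb => le.
  have Ap : etaD (eta_star R (nth q s)) by exact: etaD_gap_below h.
  have p0 := etaD_gt0 Ap.
  exists (ln (eta_star R (nth q s))); first by exists (eta_star R (nth q s)).
  have : ln (eta_star R (nth q s) * b) <= ln (a * a).
    rewrite ler_ln ?posrE ?mulr_gt0//; move: (eta_star R _) le p0 => p le p0.
    by have := sqr_ge0 (p - b); nra.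
  by rewrite !lnM ?posrE//; lra.
Qed.

(** The absolute length of the gaps of (2, 1, ..., 1) tends to the supremum G of
    all gap lengths.  Multiplied by r > 1, a remote one is therefore relatively
    longer than any gap of A near it. *)
Lemma etaD_div_gt1 r : 1 < r -> exists a b, [/\ etaD a, etaD b & a / b = r].
Proof.
move=> r1; have r0 : 0 < r by exact: lt_trans r1.
have [G hG [lenG _]] := nondecreasing_bounded_cvgn ones_length_nondecr ones_length_le1.
have len0 b : 0 < ones_length b by rewrite subr_gt0; exact: gap_left_lt_right (ones_gap_index b).
have G0 : 0 < G by exact: lt_le_trans (len0 0%N) (lenG 0%N).
have [b0 _ /(_ b0 (leqnn b0)) hb0] : \forall b \near \oo, `|G - ones_length b| < G - G / r.
  by move/cvgrPdist_lt: hG; apply; rewrite subr_gt0 ltr_pdivrMr// ltr_pMr.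
(* the length at b0 exceeds G / r, and e is what is left for b0 and beyond *)
pose e := r * ones_length b0 - G.
have e0 : 0 < e.
  have : G / r < ones_length b0 by move: hb0; rewrite ltr_norml; lra.
  by rewrite ltr_pdivrMr// /e subr_gt0 mulrC.
have [b1 hb1] := ones_left_unbounded (G ^+ 2 / e).
pose b := maxn b0 b1.
have le_len : ones_length b0 <= ones_length b by apply: ones_length_nondecr; rewrite leq_maxl.
have le_left : ones_left b1 <= ones_left b by apply: ones_left_nondecr; rewrite leq_maxr.
set x := ones_left b; set y := ones_right b; set g := ones_length b.
have x0 : 0 < x by apply: etaD_gt0; exact: ones_left_in.
have y0 : 0 < y by apply: etaD_gt0; exact: ones_right_in.
(* r x - G bounds from below the left end of a gap of A that contains r x *)
have key : G * x <= g * (r * x - G).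
  have : G ^+ 2 <= x * e.
    rewrite -ler_pdivrMr// ltW// (lt_le_trans hb1)//.
  have : 0 <= x * (r * g - G - e).
    rewrite mulr_ge0 ?(ltW x0)// /e.
    have : r * ones_length b0 <= r * g by rewrite ler_wpM2l// ltW.
    by lra.
  have : g * G <= G ^+ 2 by rewrite expr2 ler_wpM2r ?(ltW G0)//; exact: lenG.
  lra.
have Vgap : gap etaD x y.
  split; [exact: ones_left_in|exact: ones_right_in|exact: gap_left_lt_right (ones_gap_index b)|].
  by move=> _ [k kD <-]; exact: (@eta_outside_gap R q hq _ _ k (ones_gap_index b) kD).
have [c Ac hc] := etaD_unbounded (r * x).
have lr0 : 0 < ln r by exact: ln_gt0.
have [] := @meet_from_large_gap R lnA [set z | lnA (z - ln r)] (ln (eta_star R (fun=> q)))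
   (ln x) (ln c) (ln r + ln x) (ln r + ln y).
- exact: lnA_thick.
- exact: thick_shift lnA_thick.
- by move=> _ [a Aa <-]; rewrite ler_ln ?posrE ?etaD_gt0//; [exact: etaD_min|exact: etaD_const].
- apply/gap_shift; rewrite ![ln r + _]addrC !addrK.
  have [Ax Ay xy nA] := Vgap; split; [by exists x|by exists y|by rewrite ltr_ln|].
  by move=> _ [a Aa <-]; rewrite !ler_ln ?posrE ?(etaD_gt0 Aa)//; exact: nA.
- move=> _ _ /gap_ln[a [d [gad -> ->]]] /andP[]; rewrite -!lnM ?posrE//.
  have [/etaD_gt0 a0 /etaD_gt0 d0 ad _] := gad.
  rewrite !ltr_ln ?posrE ?mulr_gt0// => alt dlt.
  have dG : d - a <= G.
    have [s [j [h -> ->]]] := etaD_gapP gad.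
    exact: le_trans (gap_length_le_ones h) (lenG _).
  suff : ln (d * x) <= ln (y * a) by rewrite !lnM ?posrE//; lra.
  rewrite ler_ln ?posrE ?mulr_gt0//.
  have -> : y = x + g by rewrite /g /ones_length addrC subrK.
  have h1 : (d - a) * x <= G * x by rewrite ler_wpM2r// ltW.
  have h2 : g * (r * x - G) <= g * a by rewrite ler_wpM2l ?(ltW (len0 b))//; lra.
  by lra.
- by exists x => //; exact: ones_left_in.
- by rewrite lerDr ltW.
- by exists c.
- have c0 := etaD_gt0 Ac.
  by rewrite -lnM ?posrE// ler_ln ?posrE ?mulr_gt0.
move=> _ [a Aa <-] /= [d Ad ed]; exists a, d; split => //.
have a0 := etaD_gt0 Aa; have d0 := etaD_gt0 Ad.
apply: ln_inj; rewrite ?posrE ?divr_gt0//.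
by rewrite ln_div ?posrE// ed opprB addrC subrK.
Qed.

Lemma etaD_infprod : is_infprod_ge2 (fun n => 1 / (1 - 1 / n%:R ^+ q)) (eta_star R (fun=> q)).
Proof.
rewrite /is_infprod_ge2 -(cvg_shiftn 2).
have [cT _] := @calD_const q hq.
have <- : (fun n => star_fun (fun=> q) n.+1) =
    (fun n => \prod_(2 <= i < n + 2) (1 / (1 - 1 / i%:R ^+ q))) :> (nat -> R).
  by apply/funext => n; rewrite (star_fun_eprod hq)// addn2.
exact: calT_eta_cvg.
Qed.
End Thickness.

Theorem theorem1p1 (R : realType) (q : nat) (hq : (2 <= q)%N) :
  let etaD : set R := eta_star R @` calD q in
  let c : R := 2 * eta_star R (fun=> q) in
  let d : R := eta_star R (fun=> q) ^+ 2 in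
  [/\ [set a + b | a in etaD & b in etaD] = `[c, +oo[%classic /\
      (exists2 p : R,
         is_infprod_ge2 (fun n => 1 / (1 - 1 / n%:R ^+ q)) p & c = 2 * p),
      [set a * b | a in etaD & b in etaD] = `[d, +oo[%classic /\
      is_infprod_ge2 (fun n => 1 / (1 - 1 / n%:R ^+ q) ^+ 2) d,
      [set a - b | a in etaD & b in etaD] = [set: R] &
      [set a / b | a in etaD & b in etaD] = `]0, +oo[%classic].
Proof.
move=> etaD c d; set m := eta_star R (fun=> q) in c d *.
have Am : etaD m := etaD_const hq.
have m0 : 0 < m by exact: etaD_gt0 Am.
have minA z : etaD z -> m <= z by exact: etaD_min.
split.
- split; last by exists m => //; exact: etaD_infprod.
  apply/seteqP; split => [_ [a /minA ma] [b /minA mb] <-|t].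
    by rewrite /= in_itv /= andbT /c; lra.
  rewrite /= in_itv /= andbT /c => ct.
  have [|a [b [Aa Ab <-]]] := @thick_sum R etaD m t (etaD_thick hq) Am minA (etaD_unbounded hq).
    by lra.
  by exists a => //; exists b.
- split; last first.
    have h := @etaD_infprod R q hq; have := cvgM h h.
    rewrite /is_infprod_ge2 /d expr2 -/m.
    have -> : (fun N => \prod_(2 <= n < N) (1 / (1 - 1 / n%:R ^+ q) ^+ 2)) =
      (fun N => \prod_(2 <= n < N) (1 / (1 - 1 / n%:R ^+ q))) \*
      (fun N => \prod_(2 <= n < N) (1 / (1 - 1 / n%:R ^+ q))) :> (nat -> R).
      apply/funext => N /=; rewrite -big_split /=; apply: eq_bigr => i _.
      by rewrite expr2 invfM !mul1r.
    exact.
  apply/seteqP; split => [_ [a /minA ma] [b /minA mb] <-|t].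
    by rewrite /= in_itv /= andbT /d expr2; apply: ler_pM => //; exact: ltW.
  rewrite /= in_itv /= andbT /d => dt.
  have t0 : 0 < t by apply: lt_le_trans dt; exact: exprn_gt0.
  have [||||_ [_ [[a Aa <-] [b Ab <-] ab]]] :=
    @thick_sum R [set ln a | a in etaD] (ln m) (ln t) (lnA_thick hq).
  + by exists m.
  + by move=> _ [a Aa <-]; rewrite ler_ln ?posrE ?(etaD_gt0 Aa)//; exact: minA.
  + move=> B; have [a Aa Ba] := etaD_unbounded hq (expR B); exists (ln a); first by exists a.
    by rewrite -[B]expRK ler_ln ?posrE ?expR_gt0 ?(etaD_gt0 Aa).
  + by rewrite -lnM ?posrE// ler_ln ?posrE ?mulr_gt0// -expr2.
  exists a => //; exists b => //; have a0 := etaD_gt0 Aa; have b0 := etaD_gt0 Ab.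
  by apply: ln_inj; rewrite ?posrE ?mulr_gt0// lnM.
- apply/seteqP; split => // t _; case: (ltgtP t 0) => t0.
  + have [|a [b [Aa Ab e]]] := @etaD_sub_gt0 R q hq (- t); first by rewrite oppr_gt0.
    by exists b => //; exists a => //; lra.
  + by have [a [b [Aa Ab e]]] := etaD_sub_gt0 hq t0; exists a => //; exists b.
  + by exists m => //; exists m => //; rewrite subrr.
- apply/seteqP; split => [_ [a Aa] [b Ab] <-|t].
    by rewrite /= in_itv /= andbT divr_gt0 ?(etaD_gt0 Aa) ?(etaD_gt0 Ab).
  rewrite /= in_itv /= andbT => t0; case: (ltgtP t 1) => t1.
  + have [|a [b [Aa Ab e]]] := @etaD_div_gt1 R q hq t^-1; first by rewrite invf_gt1.
    by exists b => //; exists a => //; rewrite -[t]invrK -e invf_div.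
  + by have [a [b [Aa Ab e]]] := etaD_div_gt1 hq t1; exists a => //; exists b.
  + by exists m => //; exists m => //; rewrite t1 divff// lt0r_neq0.
Qed.
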